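(* Let $s>1$, $0<\alpha<\frac{n}{s}$, and $q\in[1,\infty)$. There exists a constant $A>0$ such that $$\int_{\mathbb{R}^n}(I_\alpha f)^q\,d\mathrm{cap}_{\alpha,s}\le A\int_{\mathbb{R}^n}f^s(I_\alpha f)^{q-s}\,dx$$ holds for all nonnegative functions $f\in L^\infty(\mathbb{R}^n)$ with compact support, and more generally for all nonnegative measurable functions $f$ on $\mathbb{R}^n$ such that $I_\alpha f\in L^q(\mathrm{cap}_{\alpha,s})$.
   Context: Here $n\ge1$ is an integer. For $0<\alpha<n$ the Riesz potential is $I_\alpha f(x)=\gamma(n,\alpha)\int_{\mathbb{R}^n}|x-y|^{\alpha-n}f(y)\,dy$, with $\gamma(n,\alpha)=\Gamma(\frac{n-\alpha}{2})/[\pi^{n/2}2^\alpha\Gamma(\frac{\alpha}{2})]$. The Riesz capacity of a set $E\subset\mathbb{R}^n$ is $\mathrm{cap}_{\alpha,s}(E)=\inf\{\|f\|_{L^s(\mathbb{R}^n)}^s: f\ge0,\ I_\alpha f\ge1\text{ on }E\}$. ''q.e.'' means except on a set of zero $\mathrm{cap}_{\alpha,s}$-capacity. For a q.e. defined $g$ with values in $[0,\infty]$, the Choquet integral is $\int_{\mathbb{R}^n}g\,d\mathrm{cap}_{\alpha,s}=\int_0^\infty\mathrm{cap}_{\alpha,s}(\{g>t\})\,dt$. $L^q(\mathrm{cap}_{\alpha,s})$ is the set of q.e. defined $u:\mathbb{R}^n\to[-\infty,\infty]$ with $\|u\|_{L^q(\mathrm{cap}_{\alpha,s})}=(\int|u|^q\,d\mathrm{cap}_{\alpha,s})^{1/q}<\infty$.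 Conventions: $\frac1\infty=0$, and $f^s(I_\alpha f)^{q-s}$ is taken to be $0$ where $f=0$. The constant $A$ does not depend on $f$. *)

(* Defs.v *)
From HB Require Import structures.
From mathcomp Require Import all_boot all_order all_algebra.
From mathcomp Require Import all_classical all_reals all_analysis measurable_realfun.
Set Implicit Arguments.
Unset Strict Implicit.
Unset Printing Implicit Defensive.
Import Order.TTheory GRing.Theory Num.Theory.
Import numFieldNormedType.Exports.
Local Open Scope classical_set_scope.
Local Open Scope ring_scope.

(* The Euclidean space of dimension n.+1 is 'rV[R]_n.+1, whose library topology
   is the usual one but whose library norm `|x| is the sup norm; the Euclidean
   norm is [enorm]. *)
Definition enorm (R : realType) (n : nat) (x : 'rV[R]_n.+1) : R :=
  Num.sqrt (\sum_(i < n.+1) x ord0 i ^+ 2).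

Section lebesgue_outer.
Context (R : realType) (n : nat).
Local Open Scope ereal_scope.
Implicit Types p : 'rV[R]_n.+1 * 'rV[R]_n.+1.

Definition box p : set 'rV[R]_n.+1 :=
  [set x | forall i, (p.1 ord0 i < x ord0 i <= p.2 ord0 i)%R].

Definition box_vol p : \bar R :=
  (\prod_(i < n.+1) Num.max 0 (p.2 ord0 i - p.1 ord0 i))%:E.

Definition lebesgue_outer (X : set 'rV[R]_n.+1) : \bar R :=
  ereal_inf [set \sum_(k <oo) box_vol (P k) | P in
    [set P : nat -> 'rV[R]_n.+1 * 'rV[R]_n.+1 | X `<=` \bigcup_k box (P k)]].

Lemma box_vol_ge0 p : 0 <= box_vol p.
Proof.
by rewrite lee_fin; apply: prodr_ge0 => i _; rewrite le_max lexx.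
Qed.

Lemma lebesgue_outer_ge0 X : 0 <= lebesgue_outer X.
Proof.
apply: le_ereal_inf_tmp => x [P _ <-]; apply: nneseries_ge0 => k _ _.
exact: box_vol_ge0.
Qed.

Lemma le_lebesgue_outer :
  {homo lebesgue_outer : A B / A `<=` B >-> A <= B}.
Proof.
move=> A B AB; apply/ereal_inf_le_tmp => x [P BP <-].
by exists P => //; exact: subset_trans AB BP.
Qed.

Lemma lebesgue_outer0 : lebesgue_outer set0 = 0.
Proof.
apply/eqP; rewrite eq_le lebesgue_outer_ge0 andbT.
apply: ereal_inf_lbound; exists (fun=> (0%R, 0%R)) => //=.
apply: eseries0 => k _ _; rewrite /box_vol big_ord_recl /=.
by rewrite !mxE subrr maxxx mul0r.
Qed.

Lemma lebesgue_outer_sigma_subadditive : sigma_subadditive lebesgue_outer.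
Proof.
move=> A; have [[i ioo]|] := pselect (exists i, lebesgue_outer (A i) = +oo).
  rewrite (eseries_pinfty _ _ ioo) ?leey// => m _.
  by rewrite -ltNye (lt_le_trans _ (lebesgue_outer_ge0 _)).
rewrite -forallNE => Aoo.
suff add2e (e : {posnum R}) : lebesgue_outer (\bigcup_m A m) <=
    \sum_(i <oo) lebesgue_outer (A i) + e%:num%:E.
  by apply/lee_addgt0Pr => _/posnumP[].
rewrite (le_trans _ (epsilon_trick _ _ _))//; last first.
  by move=> m; exact: lebesgue_outer_ge0.
pose Q m (B : nat -> 'rV[R]_n.+1 * 'rV[R]_n.+1) :=
  A m `<=` \bigcup_k box (B k) /\ \sum_(k <oo) box_vol (B k) <=
    lebesgue_outer (A m) + (e%:num / (2 ^ m.+1)%:R)%:E.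
have [G PG] : {G : nat -> nat -> 'rV[R]_n.+1 * 'rV[R]_n.+1
    & forall m, Q m (G m)}.
  apply: (@choice _ _ Q) => m; rewrite /Q.
  have en1 : (0 < e%:num / (2 ^ m.+1)%:R)%R by [].
  have fA : lebesgue_outer (A m) \is a fin_num.
    by rewrite ge0_fin_numE ?lebesgue_outer_ge0// ltey; apply/eqP; exact: Aoo.
  have [x [B AB <-] /ltW xS] := lb_ereal_inf_adherent en1 fA.
  by exists B.
have vG_ge0 x : 0 <= (box_vol \o uncurry G) x by exact: box_vol_ge0.
apply: (@le_trans _ _ (\esum_(i in setT) (box_vol \o uncurry G) i)).
  apply: ereal_inf_lbound => /=.
  have /card_esym/ppcard_eqP[f] := card_nat2.
  exists (uncurry G \o f).
    move=> t [i _ /(PG i).1[j _ Bijt]].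
    by exists (f^-1%FUN (i, j)) => //=; rewrite invK ?inE.
  rewrite -(esum_pred_image (box_vol \o uncurry G) _ xpredT) ?[fun=> _]set_true//.
  by rewrite image_eq.
rewrite (_ : esum _ _ = \sum_(i <oo) \sum_(j <oo) box_vol (G i j)); last first.
  pose J : nat -> set (nat * nat) := fun i => [set (i, j) | j in setT].
  rewrite (_ : setT = \bigcup_k J k); last first.
    by rewrite predeqE => -[a b]; split => // _; exists a => //; exists b.
  rewrite esum_bigcupT /=; last 2 first.
    - apply/trivIsetP => i j _ _ ij.
      rewrite predeqE => -[k m] /=; split => //= -[] [_] _ [<-{k} _].
      by move=> [m' _] [] /esym/eqP; rewrite (negbTE ij).
    - by move=> /= [k m]; exact: box_vol_ge0.
  rewrite -(image_id [set: nat]) -fun_true esum_pred_image//; last first.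
    by move=> k _; apply: esum_ge0 => j _; exact: box_vol_ge0.
  apply: eq_eseriesr => /= j _.
  rewrite -(esum_pred_image (box_vol \o uncurry G) (pair j) predT)//=; last 2 first.
  - by move=> k _; exact: box_vol_ge0.
  - by move=> ? ? _ _; exact: (@can_inj _ _ _ snd).
  by congr esum; rewrite predeqE => -[a b]; split; move=> [i _ <-]; exists i.
apply: lee_lim.
- apply: is_cvg_nneseries => k *.
  by apply: nneseries_ge0 => m *; exact: (vG_ge0 (k, m)).
- apply: is_cvg_nneseries => k *.
  by apply: adde_ge0 => //; exact: lebesgue_outer_ge0.
- by near=> m; apply: lee_sum => i _; exact: (PG i).2.
Unshelve. all: by end_near. Qed.

HB.instance Definition _ := isOuterMeasure.Build R 'rV[R]_n.+1 lebesgue_outer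
  lebesgue_outer0 lebesgue_outer_ge0 le_lebesgue_outer
  lebesgue_outer_sigma_subadditive.

End lebesgue_outer.

(* 'rV[R]_n.+1 with the sigma-algebra of all Lebesgue (not only Borel)
   measurable sets *)
Notation Rn R n := (caratheodory_type (@lebesgue_outer R n)).

Section lebesgue_measure_Rn.
Context (R : realType) (n : nat).
Local Open Scope ereal_scope.

Definition leb : set (Rn R n) -> \bar R := @lebesgue_outer R n.

Let leb0 : leb set0 = 0. Proof. exact: lebesgue_outer0. Qed.

Let leb_ge0 X : 0 <= leb X. Proof. exact: lebesgue_outer_ge0. Qed.

Let leb_sigma_additive : semi_sigma_additive leb.
Proof. exact: (@caratheodory_measure_sigma_additive _ _ (@lebesgue_outer R n)). Qed.

HB.instance Definition _ := isMeasure.Build _ _ _ leb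
  leb0 leb_ge0 leb_sigma_additive.

End lebesgue_measure_Rn.
Arguments leb : clear implicits.

Section potentials_and_capacities.
Context (R : realType) (n : nat).
Local Open Scope ereal_scope.
Implicit Types (f u g : 'rV[R]_n.+1 -> \bar R) (E : set 'rV[R]_n.+1).

(* x ^ r on [0, +oo] with 0 ^ r = +oo and +oo ^ r = 0 for r < 0; the library's
   [poweR] would give 0 and +oo instead. *)
Definition xpow (x : \bar R) (r : R) : \bar R :=
  if (0 <= r)%R then x `^ r else (x `^ (- r))^-1.

Definition Gamma (z : R) : R :=
  Rintegral lebesgue_measure `]0%R, +oo[
    (fun t : R => t `^ (z - 1) * expR (- t))%R.

Definition riesz_const (alpha : R) : R :=
  (Gamma ((n.+1%:R - alpha) / 2) /
    (pi `^ (n.+1%:R / 2) * 2 `^ alpha * Gamma (alpha / 2)))%R.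

Definition riesz_potential (alpha : R) f (x : 'rV[R]_n.+1) : \bar R :=
  (riesz_const alpha)%:E *
  \int[leb R n]_y (xpow (enorm (x - y))%:E (alpha - n.+1%:R) * f y).

Definition riesz_cap (alpha s : R) E : \bar R :=
  ereal_inf [set 'N[leb R n]_s%:E[f] `^ s | f in
    [set f : 'rV[R]_n.+1 -> \bar R |
      [/\ measurable_fun [set: Rn R n] f, forall x, 0 <= f x &
          forall x, E x -> 1 <= riesz_potential alpha f x]]].

Definition choquet (c : set 'rV[R]_n.+1 -> \bar R) g : \bar R :=
  \int[lebesgue_measure]_(t in `]0%R, +oo[) c [set x | t%:E < g x].

Definition cap_norm (alpha s q : R) u : \bar R :=
  choquet (riesz_cap alpha s) (fun x => `|u x| `^ q) `^ q^-1.

(* Support in the sense of distributions, hence independent of the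
   representative of f modulo null sets; it is contained in the closure of
   [set x | f x != 0]. *)
Definition ess_support f : set 'rV[R]_n.+1 :=
  [set x | ~ exists2 U, nbhs x U & {ae leb R n, forall y, U y -> f y = 0}].

Definition bounded_compact_support f : Prop :=
  'N[leb R n]_+oo[f] < +oo /\ compact (ess_support f).

End potentials_and_capacities.

Arguments riesz_potential {R n}.
Arguments riesz_cap {R n}.
Arguments choquet {R n}.
Arguments cap_norm {R n}.

(* Main.v *)
Require Import Defs.
From HB Require Import structures.
From mathcomp Require Import all_boot all_order all_algebra.
From mathcomp Require Import all_classical all_reals all_analysis measurable_realfun ess_sup_inf.
From mathcomp Require Import ring lra.
Set Implicit Arguments.
Unset Strict Implicit.
Unset Printing Implicit Defensive.
Import Order.TTheory GRing.Theory Num.Theory.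
Import numFieldNormedType.Exports.
Local Open Scope classical_set_scope.
Local Open Scope ring_scope.
Local Open Scope ereal_scope.

(* Let v = int |x - y|^(alpha-n) f(y) dy, taken with the sup norm, which only
   changes the potential by constants. The heart of the matter is the level
   estimate, with b = p (s - 1) for some p > 1 close to 1 and a small e > 0,
     cap {v > C t} <= C' t^(b - s) int_{v > e t} f^s v^(-b) dx,
   which integrated in t (layer cake, Tonelli) gives the theorem, as b < s and
   q - s + b > 0.
   To prove it, let r(x) be the largest r with
   int (r + |x - z|)^(alpha-n) f(z) dz > t; this stopping radius is 1-Lipschitz
   and is positive only where v > t. Replace f by its means over the balls of
   radius r(x) / 2 where r(x) > 0, and keep f where r(x) = 0 and v exceeds a
   small multiple of t. By a boundedness principle the discarded part of f
   contributes at most t / 2, so a multiple of the potential of the new function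
   h is at least t on {v > C t}, and h / t is admissible for the capacity. The
   mean of v^p over the balls is at most C t^p (this is where p close to 1 is
   used), so Hoelder's inequality bounds (mean of f)^s by
   t^b times the mean of f^s v^(-b), and int h^s by t^b int f^s v^(-b). *)

(** * Lebesgue measure of balls *)

(** The shift r + |x - z|, unlike a cut-off, makes a displacement of x interchangeable with a change
    of r. This gives the Lipschitz property of the stopping radius, hence comparable radii at nearby
    points and bounded overlap of the balls. With g = n - alpha, three conditions fix p: g p < n, so
    that the kernel is locally in L^p; p (s - 1) < s, so that the level exponent (s - b) / q is
    positive; and p > 1, so that q - s + b = (q - 1) + (p - 1) (s - 1) is positive even for q = 1,
    since otherwise the integral over the levels diverges at 0. The restriction to {v > e t} stops
    that integral at a multiple of v(x). The capacity enters only through its monotonicity and one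
    admissible function per level. The stopping argument is stated for a measure with ball bounds of
    order r^D; for the sup norm balls are cubes, whose volumes are explicit. *)

Section lebesgue_Rn.
Context (R : realType) (n : nat).
Implicit Types p : 'rV[R]_n.+1 * 'rV[R]_n.+1.

Let setc (x : 'rV[R]_n.+1) i (a : R) : 'rV[R]_n.+1 :=
  \row_j (if j == i then a else x ord0 j).

(** Clamping [a] to the side covers hyperplanes that miss the box and empty boxes. *)
Lemma box_vol_split p i (a : R) :
  box_vol p = box_vol (p.1, setc p.2 i (Num.min (p.2 ord0 i) (Num.max (p.1 ord0 i) a))) +
    box_vol (setc p.1 i (Num.min (p.2 ord0 i) (Num.max (p.1 ord0 i) a)), p.2).
Proof.
set m := Num.min _ _.
rewrite /box_vol -EFinD; congr EFin.
have D1 (F : 'I_n.+1 -> R) : (\prod_j F j = F i * \prod_(j | j != i) F j)%R.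
  exact: bigD1.
rewrite !D1/= !mxE eqxx.
set c := (\prod_(j < n.+1 | j != i) _)%R.
have -> : (\prod_(j < n.+1 | j != i) Num.max 0 (setc p.2 i m ord0 j - p.1 ord0 j) = c)%R.
  by apply: eq_bigr => j /negbTE ji; rewrite !mxE ji.
have -> : (\prod_(j < n.+1 | j != i) Num.max 0 (p.2 ord0 j - setc p.1 i m ord0 j) = c)%R.
  by apply: eq_bigr => j /negbTE ji; rewrite !mxE ji.
rewrite -mulrDl; congr (_ * _)%R; rewrite {}/m.
move: (p.1 ord0 i) (p.2 ord0 i) => u v.
rewrite !maxEle !minEle; repeat case: ifPn; lra.
Qed.

(** The hyperplane cuts a cover by boxes into covers of the two parts with the same total volume. *)
Lemma caratheodory_halfspace i (a : R) :
  (@lebesgue_outer R n).-caratheodory [set x | (x ord0 i <= a)%R].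
Proof.
apply: le_caratheodory_measurable => X.
rewrite [leRHS]/(lebesgue_outer X); apply: le_ereal_inf_tmp => _ [P XP <-].
pose m k := Num.min ((P k).2 ord0 i) (Num.max ((P k).1 ord0 i) a).
pose P1 k := ((P k).1, setc (P k).2 i (m k)).
pose P2 k := (setc (P k).1 i (m k), (P k).2).
have -> : \sum_(k <oo) box_vol (P k) =
    \sum_(k <oo) box_vol (P1 k) + \sum_(k <oo) box_vol (P2 k).
  rewrite -nneseriesD; [|by move=> *; exact: box_vol_ge0..].
  by apply: eq_eseriesr => k _; exact: box_vol_split.
apply: leeD; apply: ereal_inf_lbound.
- exists P1 => // x [/XP[k _ Pk] /= xa]; exists k => // j; have /andP[h1 h2] := Pk j.
  rewrite /= h1 mxE; case: eqP => [ji|//]; subst j.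
  by rewrite /m le_min h2 le_max xa orbT.
- exists P2 => // x [/XP[k _ Pk] /= xa]; exists k => // j; have /andP[h1 h2] := Pk j.
  rewrite /= h2 mxE; case: eqP => [ji|_]; last by rewrite h1.
  subst j; move/negP : xa; rewrite -ltNge => xa.
  by rewrite /m gt_min gt_max h1 xa /= orbT.
Qed.

Lemma measurable_coord i :
  measurable_fun [set: Rn R n] (fun x : Rn R n => x ord0 i : R).
Proof.
move=> mT; apply: (measurability _ (RGenOInfty.measurableE R)) => //.
move=> _ [_ [a ->] <-]; rewrite setTI.
rewrite (_ : _ @^-1` _ = ~` [set x : Rn R n | (x ord0 i <= a)%R]); last first.
  by apply/seteqP; split => x /=; rewrite in_itv/= andbT ltNge => /negP.
by apply: measurableC; exact: caratheodory_halfspace.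
Qed.

End lebesgue_Rn.

(** * Lower bound for the outer measure of a box *)

Section box_lower_bound.
Context (R : realType).

Lemma integral_cst_itv (c a b : R) : (0 <= c)%R ->
  \int[lebesgue_measure]_y (c * \1_(`]a, b]%classic : set R) y)%:E =
  (c * Num.max 0 (b - a))%:E.
Proof.
move=> c0; under eq_integral do rewrite EFinM.
rewrite ge0_integralZl//; last exact/measurable_EFinP.
rewrite integral_indic// setIT EFinM; congr (_ * _).
rewrite [LHS](lebesgue_measure_itv `]a, b])/= lte_fin -EFinB maxEle subr_ge0.
by case: ltgtP => // ->; rewrite subrr.
Qed.

(* Integrating one coordinate at a time against the one-dimensional Lebesgue
   measure avoids product measures in the bound of box volumes by [lebesgue_outer]. *)
Lemma le_prod_of_indic_cover (m : nat) (c0 : R) (c : nat -> R) (a b : nat -> R)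
    (ak bk : nat -> nat -> R) :
  (0 <= c0)%R -> (forall k, 0 <= c k)%R ->
  (forall x : nat -> R,
    (c0 * \prod_(i < m) \1_(`]a i, b i]%classic : set R) (x i))%:E <=
    \sum_(k <oo) (c k * \prod_(i < m) \1_(`]ak k i, bk k i]%classic : set R) (x i))%:E) ->
  (c0 * \prod_(i < m) Num.max 0 (b i - a i))%:E <=
    \sum_(k <oo) (c k * \prod_(i < m) Num.max 0 (bk k i - ak k i))%:E.
Proof.
have prod_ge0 (r s x : nat -> R) k :
    (0 <= \prod_(i < k) \1_(`]r i, s i]%classic : set R) (x i))%R.
  by apply: prodr_ge0 => i _; rewrite indicE.
elim: m c0 c => [|m IH] c0 c c00 ck0 H.
  by move: (H (fun=> 0%R)); rewrite !big_ord0; under eq_eseriesr do rewrite !big_ord0;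
     under [in X in _ -> X]eq_eseriesr do rewrite !big_ord0.
(* The last side moves into the coefficients, hence the general [c0] and [c]; integrating in the
   last variable gives the hypothesis for the shorter product. *)
rewrite big_ord_recr/= mulrA mulrAC.
under eq_eseriesr do rewrite big_ord_recr/= mulrA mulrAC.
apply: IH => [|k|x].
- by rewrite mulr_ge0// le_max lexx.
- by rewrite mulr_ge0// le_max lexx.
pose x' y i : R := if i == m then y else x i.
have E (r s : nat -> R) y :
    (\prod_(i < m.+1) \1_(`]r i, s i]%classic : set R) (x' y i) =
     \prod_(i < m) \1_(`]r i, s i]%classic : set R) (x i) * \1_(`]r m, s m]%classic : set R) y)%R.
  rewrite big_ord_recr/= {2}/x' eqxx; congr (_ * _)%R.
  by apply: eq_bigr => i _; rewrite /x' ltn_eqF.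
rewrite mulrAC -integral_cst_itv ?mulr_ge0//.
under eq_eseriesr do rewrite mulrAC -integral_cst_itv ?mulr_ge0//.
rewrite -integral_nneseries//; last 2 first.
- move=> k; apply/measurable_EFinP; exact: measurable_funM.
- by move=> k y _; rewrite lee_fin !mulr_ge0// indicE.
apply: ge0_le_integral => //.
- by move=> y _; rewrite lee_fin !mulr_ge0// indicE.
- apply/measurable_EFinP; exact: measurable_funM.
- apply: (ge0_emeasurable_sum (P := xpredT)) => [k y _ _|k _].
    by rewrite lee_fin !mulr_ge0// indicE.
  apply/measurable_EFinP; exact: measurable_funM.
- move=> y _; have := H (x' y); rewrite E mulrA.
  by under eq_eseriesr do rewrite E mulrA.
Qed.

(** A cover bounds the indicator of the box by the sum of the indicators of its members; this is
    integrated coordinate by coordinate. *)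
Lemma box_vol_le_outer (n : nat) (p : 'rV[R]_n.+1 * 'rV[R]_n.+1) :
  box_vol p <= lebesgue_outer (box p).
Proof.
apply: le_ereal_inf_tmp => _ [P XP <-].
pose ex (x : 'rV[R]_n.+1) (i : nat) : R := x ord0 (inord i).
have exE x (i : 'I_n.+1) : ex x i = x ord0 i by rewrite /ex inord_val.
have volE q : box_vol q = (1 * \prod_(i < n.+1) Num.max 0 (ex q.2 i - ex q.1 i))%:E.
  by rewrite /box_vol mul1r; congr EFin; apply: eq_bigr => i _; rewrite !exE.
rewrite volE; under eq_eseriesr do rewrite volE.
apply: (@le_prod_of_indic_cover n.+1 1 (fun=> 1%R) (ex p.1) (ex p.2)
  (fun k => ex (P k).1) (fun k => ex (P k).2)) => // x.
pose y : 'rV[R]_n.+1 := \row_i x i.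
have indE q : (\prod_(i < n.+1) \1_(`](ex q.1 i), (ex q.2 i)]%classic : set R) (x i) =
    \1_(box q) y :> R)%R.
  rewrite indicE; case: (boolP (y \in box q)) => [|/negP]; rewrite inE => yq.
    apply: big1 => i _; rewrite indicE mem_set//= in_itv/= !exE.
    by have := yq i; rewrite mxE.
  have /existsNP[i yi] : ~ forall i, (q.1 ord0 i < y ord0 i <= q.2 ord0 i)%R by [].
  apply/eqP; rewrite prodf_seq_eq0/=; apply/hasP; exists i; first by rewrite mem_index_enum.
  rewrite indicE memNset//= in_itv/= !exE => h; apply: yi; by rewrite mxE.
rewrite mul1r indE; under eq_eseriesr do rewrite mul1r indE.
rewrite indicE; case: (boolP (y \in box p)) => [|_]; last first.
  by apply: nneseries_ge0 => k _ _; rewrite lee_fin.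
rewrite inE => /XP[k _ yk].
rewrite (@nneseries_split _ _ 0 k)// add0n.
apply: le_trans (leeDr _ _); last first.
  by apply: sume_ge0 => i _; rewrite lee_fin.
rewrite (@nneseries_split _ _ k 1)//.
rewrite addn1 big_nat1 [X in X%:E + _]indicE mem_set//.
by rewrite leeDl// nneseries_ge0// => i _ _; rewrite lee_fin.
Qed.

End box_lower_bound.

Section lebesgue_balls.
Context (R : realType) (n : nat).
Implicit Types x y : 'rV[R]_n.+1.

Lemma norm_rV_ltP x (r : R) : (0 < r)%R ->
  reflect (forall i, `|x ord0 i| < r)%R (`|x| < r)%R.
Proof.
move=> r0; rewrite {2}/Num.norm/= mx_normrE; apply: (iffP idP).
  by move=> /bigmax_ltP[_ h] i; exact: (h (ord0, i)).
by move=> h; apply/bigmax_ltP; split => // -[i j] _; rewrite (ord1 i); exact: h.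
Qed.

Lemma norm_rV_coord x i : (`|x ord0 i| <= `|x|)%R.
Proof.
rewrite [leRHS]/Num.norm/= mx_normrE.
exact: (@le_bigmax_cond _ _ _ _ (ord0, i) xpredT (fun ij => `|x ij.1 ij.2|)%R).
Qed.

Lemma measurable_norm_rVB :
  measurable_fun [set: Rn R n * Rn R n]
    (fun z : Rn R n * Rn R n => `|(z.1 : 'rV[R]_n.+1) - z.2|%R : R).
Proof.
rewrite (_ : (fun z : Rn R n * Rn R n => _) = fun z : Rn R n * Rn R n =>
   \big[Num.max/0%R]_(ij : 'I_1 * 'I_n.+1) `|z.1 ord0 ij.2 - z.2 ord0 ij.2|%R); last first.
  apply/funext => z; rewrite [LHS]/Num.norm/= mx_normrE; apply: eq_bigr => -[i j] _.
  by rewrite !mxE (ord1 i).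
elim: (index_enum _) => [|ij s IH].
  rewrite (_ : (fun z => _) = cst 0%R); first exact: measurable_cst.
  by apply/funext => z; rewrite big_nil.
under eq_fun do rewrite big_cons.
apply: measurable_maxr => //.
apply: (measurableT_comp (@normr_measurable R setT)).
apply: measurable_funB.
- exact: (measurableT_comp (measurable_coord ij.2) measurable_fst).
- exact: (measurableT_comp (measurable_coord ij.2) measurable_snd).
Qed.

Lemma measurable_norm_rVBl x :
  measurable_fun [set: Rn R n] (fun y : Rn R n => `|x - (y : 'rV[R]_n.+1)|%R : R).
Proof. exact: (measurableT_comp measurable_norm_rVB (measurable_pair1 (x : Rn R n))). Qed.

Lemma measurable_rV_ball x (r : R) : measurable [set y : Rn R n | (`|x - (y : 'rV[R]_n.+1)| < r)%R].
Proof.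
have := @measurable_fun_ltr _ _ _ setT _ _ (measurable_norm_rVBl x) (measurable_cst r).
by move=> /(_ measurableT [set true] I); rewrite setTI.
Qed.

Lemma leb_ball_le x (r : R) : (0 < r)%R ->
  leb R n [set y | (`|x - y| < r)%R] <= ((2 * r) ^+ n.+1)%:E.
Proof.
move=> r0; pose c : 'rV[R]_n.+1 := const_mx r.
pose P k := if k is 0%N then (x - c, x + c)%R else (0%R : 'rV[R]_n.+1, 0%R : 'rV[R]_n.+1).
apply: (@le_trans _ _ (\sum_(k <oo) box_vol (P k))).
  apply: ereal_inf_lbound; exists P => // y /(norm_rV_ltP _ r0) h.
  exists 0%N => // i; have := h i; rewrite !mxE ltr_norml => /andP[h1 h2].
  by apply/andP; split; lra.
rewrite (@nneseries_split _ _ 0 1)//; last by move=> *; exact: box_vol_ge0.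
rewrite add0n big_nat1 eseries0 ?adde0; last first.
  move=> [//|k] _ _; rewrite /box_vol/= big_ord_recl !mxE subrr maxxx mul0r//.
rewrite /box_vol/= lee_fin.
under eq_bigr do rewrite !mxE.
rewrite (eq_bigr (fun=> 2 * r)%R) ?prodr_const ?card_ord// => i _.
by rewrite max_r; lra.
Qed.

Lemma leb_ball_ge x (r : R) : (0 < r)%R ->
  (r ^+ n.+1)%:E <= leb R n [set y | (`|x - y| < r)%R].
Proof.
(* Half the radius, so that the box, which contains its upper faces, lies in the open ball. *)
move=> r0; pose c : 'rV[R]_n.+1 := const_mx (r / 2)%R.
apply: (@le_trans _ _ (lebesgue_outer (box (x - c, x + c)%R))); last first.
  apply: le_lebesgue_outer => y /= h; apply/(norm_rV_ltP _ r0) => i.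
  by have := h i; rewrite /= !mxE ltr_norml => /andP[h1 h2]; apply/andP; split; lra.
apply: le_trans (box_vol_le_outer _); rewrite /box_vol/= lee_fin.
under eq_bigr do rewrite !mxE.
rewrite (eq_bigr (fun=> r)%R) ?prodr_const ?card_ord// => i _.
by rewrite max_r; lra.
Qed.

Lemma leb_sigma_finite : sigma_finite [set: Rn R n] (leb R n).
Proof.
exists (fun k => [set y : Rn R n | (`|0 - (y : 'rV[R]_n.+1)| < k.+1%:R)%R]).
  apply/seteqP; split => // y _; exists (Num.trunc `|y : 'rV[R]_n.+1|%R) => //=.
  rewrite sub0r normrN; exact: truncnS_gt.
move=> k; split; first exact: measurable_rV_ball.
by apply: le_lt_trans (leb_ball_le _ _) _; rewrite ?ltry.
Qed.

HB.instance Definition _ := Measure_isSigmaFinite.Build _ _ _ (leb R n) leb_sigma_finite.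

End lebesgue_balls.

(* Locked: otherwise the unifier unfolds the norm of 'rV[R]_n.+1 at great cost. *)
HB.lock Definition sdist (R : realType) (n : nat) (x y : 'rV[R]_n.+1) : R := `|x - y|%R.

Section sdist_theory.
Context (R : realType) (n : nat).
Implicit Types x y z : 'rV[R]_n.+1.

Lemma sdistE x y : sdist x y = `|x - y|%R. Proof. by rewrite unlock. Qed.

Lemma sdist_ge0 x y : (0 <= sdist x y)%R. Proof. by rewrite sdistE. Qed.

Lemma sdistC x y : sdist x y = sdist y x. Proof. by rewrite !sdistE distrC. Qed.

Lemma sdist_tri y x z : (sdist x z <= sdist x y + sdist y z)%R.
Proof. by rewrite !sdistE ler_distD. Qed.

Lemma measurable_sdist2 :
  measurable_fun [set: Rn R n * Rn R n] (fun z : Rn R n * Rn R n => sdist z.1 z.2).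
Proof. rewrite unlock; exact: measurable_norm_rVB. Qed.

Lemma measurable_sdistl x : measurable_fun [set: Rn R n] (fun y : Rn R n => sdist x y).
Proof. rewrite unlock; exact: measurable_norm_rVBl. Qed.

Definition sball x (r : R) : set (Rn R n) := [set y : Rn R n | (sdist x y < r)%R].

Lemma measurable_sball x r : measurable (sball x r).
Proof. rewrite /sball unlock; exact: measurable_rV_ball. Qed.

Lemma leb_sball_le x (r : R) : (0 < r)%R ->
  leb R n (sball x r) <= ((2 * r) ^+ n.+1)%:E.
Proof. rewrite /sball unlock; exact: leb_ball_le. Qed.

Lemma leb_sball_ge x (r : R) : (0 < r)%R ->
  (r ^+ n.+1)%:E <= leb R n (sball x r).
Proof. rewrite /sball unlock; exact: leb_ball_ge. Qed.

End sdist_theory.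

(** * Powers on [0, +oo] *)

Section xpow_theory.
Context (R : realType).
Implicit Types (x y : \bar R) (r c : R).

Lemma xpow_ge0 x r : 0 <= xpow x r.
Proof. by rewrite /xpow; case: ifPn => _; rewrite ?inve_ge0 poweR_ge0. Qed.

Lemma xpow_EFin c r : (0 < c)%R -> xpow c%:E r = (c `^ r)%:E.
Proof.
move=> c0; rewrite /xpow; case: ifPn => // _.
by rewrite poweR_EFin inver gt_eqF ?powR_gt0// powRN invrK.
Qed.

Lemma xpow0 r : (r < 0)%R -> xpow 0 r = +oo.
Proof. by move=> r0; rewrite /xpow ifN -?ltNge// poweR0r ?inve0// oppr_eq0 lt_eqF. Qed.

Lemma xpowy r : (r < 0)%R -> xpow +oo r = 0.
Proof. by move=> r0; rewrite /xpow ifN -?ltNge// poweRyr ?invey// oppr_eq0 lt_eqF. Qed.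

Lemma xpow_ndecr x y r : (0 <= r)%R -> 0 <= x -> x <= y -> xpow x r <= xpow y r.
Proof.
move=> r0 x0 xy; rewrite /xpow r0.
apply: gt0_ler_poweR => //.
all: by rewrite in_itv/= leey andbT// (le_trans x0).
Qed.

Lemma xpow_nincr x y r : (r < 0)%R -> 0 <= x -> x <= y -> xpow y r <= xpow x r.
Proof.
move=> r0 x0 xy; rewrite /xpow !ifN -?ltNge//.
rewrite lee_pV2 ?inE ?poweR_ge0//.
apply: gt0_ler_poweR => //; first by rewrite oppr_ge0 ltW.
all: by rewrite in_itv/= leey andbT// (le_trans x0).
Qed.

Lemma xpowM c x r : (0 < c)%R -> 0 <= x -> xpow (c%:E * x) r = (c `^ r)%:E * xpow x r.
Proof.
move=> c0 x0; case: (ltP r 0%R) => r0; last first.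
  by rewrite /xpow r0 poweRM ?lee_fin ?(ltW c0)//.
case: x x0 => [x|_|//].
  rewrite lee_fin le_eqVlt => /predU1P[<-|x0].
    by rewrite mule0 xpow0// gt0_muley// lte_fin powR_gt0.
  by rewrite -EFinM !xpow_EFin ?mulr_gt0// powRM ?ltW.
by rewrite gt0_muley ?lte_fin// xpowy// mule0.
Qed.

Lemma measurable_xpow d (T : measurableType d) (f : T -> \bar R) r :
  measurable_fun [set: T] f -> (forall z, 0 <= f z) ->
  measurable_fun [set: T] (fun z => xpow (f z) r).
Proof.
move=> mf f0; case: (ltP r 0%R) => r0; last first.
  rewrite /xpow r0; exact: (measurableT_comp (measurable_poweR r)).
(* For negative [r], [xpow] and [poweR] differ only at 0 and +oo. *)
rewrite (_ : (fun z => _) = fun z => if f z == 0 then +oo else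
   if f z == +oo then 0 else f z `^ r); last first.
  apply/funext => z; case: eqP => [->|fx0]; first by rewrite xpow0.
  case: eqP => [->|fxy]; first by rewrite xpowy.
  move: (f0 z) fx0 fxy; case: (f z) => // y; rewrite lee_fin => y0 yn0 _.
  rewrite xpow_EFin// lt_neqAle y0 andbT eq_sym.
  by apply/eqP => y00; apply: yn0; rewrite y00.
apply: measurable_fun_ifT => //; first exact: measurable_fun_eqe.
apply: measurable_fun_ifT => //; first exact: measurable_fun_eqe.
exact: (measurableT_comp (measurable_poweR r)).
Qed.

End xpow_theory.

(** * Integrals of power kernels over balls *)

Definition shell_const (R : realType) (D g : R) : R :=
  (2 `^ g / (1 - 2 `^ (g - D)))%R.

Lemma powR2_lt1 (R : realType) (a : R) : (a < 0)%R -> (2 `^ a < 1 :> R)%R.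
Proof.
move=> a0; rewrite /powR pnatr_eq0/= expR_lt1.
by rewrite nmulr_rlt0// ln_gt0// ltr1n.
Qed.

Lemma shell_const_gt0 (R : realType) (D g : R) : (g < D)%R -> (0 < shell_const D g)%R.
Proof. by move=> gD; rewrite divr_gt0 ?powR_gt0// subr_gt0 powR2_lt1// subr_lt0. Qed.

Section shells.
Context d (T : measurableType d) (R : realType) (mu : {measure set T -> \bar R}).
Variables (dist : T -> R) (D g C : R).
Hypotheses (mdist : measurable_fun [set: T] dist) (dist0 : forall x, (0 <= dist x)%R).
Hypotheses (g0 : (0 < g)%R) (gD : (g < D)%R).
Hypothesis mu_ball : forall r, (0 < r)%R ->
  mu [set x | (dist x < r)%R] <= (C * r `^ D)%:E.

Let mball r : measurable [set x | (dist x < r)%R].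
Proof.
have := @measurable_fun_ltr _ _ _ setT _ _ mdist (measurable_cst r).
by move=> /(_ measurableT [set true] I); rewrite setTI.
Qed.

(** Indicators of balls instead of shells: overlaps only increase the sum, and the measures of balls
    are what is controlled. *)
Let shell r j x : R :=
  ((r / 2 ^+ j.+1) `^ (- g) * \1_[set y | (dist y < r / 2 ^+ j)%R] x)%R.

Let shell_ge0 r j x : (0 <= (shell r j x)%:E).
Proof. by rewrite lee_fin mulr_ge0 ?powR_ge0// indicE. Qed.

(** Using [e] instead of [dist x] also serves [dist x = 0]: there every small [e] is allowed, so the
    sum is +oo. *)
Let shell_lb (r e : R) x : (0 < e)%R -> (e < r)%R -> (dist x <= e)%R ->
  (e `^ (- g))%:E <= \sum_(j <oo) (shell r j x)%:E.
Proof.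
move=> e0 er xe; have r0 := lt_trans e0 er.
have exj : exists j, (r / 2 ^+ j.+1 <= e)%R.
  exists (Num.trunc (r / e)); rewrite ler_pdivrMr ?exprn_gt0//.
  rewrite mulrC -ler_pdivrMr//.
  apply/ltW/(lt_trans (truncnS_gt _)).
  by rewrite -natrX ltr_nat ltn_expl.
have [j je jmin] := ex_minnP exj.
have ej : (e < r / 2 ^+ j)%R.
  case: j je jmin => [_ _|j _ jmin]; first by rewrite expr0 divr1.
  by rewrite ltNge; apply/negP => /jmin; rewrite ltnn.
apply: (@le_trans _ _ (shell r j x)%:E).
  rewrite lee_fin /shell indicE mem_set/= ?mulr1; last exact: le_lt_trans ej.
  rewrite !powRN lef_pV2 ?posrE ?powR_gt0 ?divr_gt0 ?exprn_gt0//.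
  by apply: ge0_ler_powR => //; rewrite ?nnegrE ?(ltW g0) ?(ltW e0)// ltW// divr_gt0 ?exprn_gt0.
rewrite (@nneseries_split _ _ 0 j)// add0n.
apply: le_trans (leeDr _ _); last by apply: sume_ge0.
by rewrite (@nneseries_split _ _ j 1)// addn1 big_nat1 leeDl// nneseries_ge0.
Qed.

(** Taking the kernel at the inner radius r / 2^(j+1) of each shell gives a geometric series of
    ratio 2^(g - D) < 1, with sum C * [shell_const] * r^(D - g). *)
Lemma integral_shell (r : R) : (0 < r)%R ->
  \int[mu]_(x in [set x | (dist x < r)%R]) xpow (dist x)%:E (- g) <=
  (C * shell_const D g * r `^ (D - g))%:E.
Proof.
move=> r0.
have Ng0 : (- g < 0)%R by rewrite oppr_lt0.
have mxp : measurable_fun [set: T] (fun x => xpow (dist x)%:E (- g)).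
  by apply: measurable_xpow => //; exact/measurable_EFinP.
have msh j : measurable_fun [set: T] (fun x => (shell r j x)%:E).
  by apply/measurable_EFinP; apply: measurable_funM.
apply: (@le_trans _ _ (\int[mu]_x \sum_(j <oo) (shell r j x)%:E)).
  rewrite integral_mkcond; apply: ge0_le_integral => //.
  - by move=> x _; apply: erestrict_ge0 => y _; exact: xpow_ge0.
  - by apply/(measurable_restrictT _ _).1 => //; exact: measurable_funTS.
  - by apply: (ge0_emeasurable_sum (P := xpredT)).
  move=> x _; rewrite patchE; case: ifPn => [|_]; last exact: nneseries_ge0.
  rewrite inE/= => xr.
  have := dist0 x; rewrite le_eqVlt => /predU1P[x0|x0]; last first.
    by rewrite xpow_EFin//; exact: shell_lb.
  rewrite -x0 xpow0//; rewrite leye_eq; apply/eqP/eqyP => A A0.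
  pose e := Num.min (r / 2)%R (A `^ (- g^-1))%R.
  have e0 : (0 < e)%R by rewrite lt_min powR_gt0// andbT divr_gt0.
  apply: (@le_trans _ _ (e `^ (- g))%:E); last apply: shell_lb => //.
  - rewrite lee_fin.
    rewrite [leLHS](_ : A = ((A `^ (- g^-1)) `^ (- g))%R); last first.
      by rewrite -powRrM mulrNN mulVf ?gt_eqF// powRr1// ltW.
    have B0 := powR_gt0 (- g^-1) A0.
    have : (e <= A `^ (- g^-1))%R by rewrite /e ge_min lexx orbT.
    move: (A `^ (- g^-1))%R B0 => B B0 eB.
    rewrite !powRN lef_pV2 ?posrE ?powR_gt0//.
    by apply: ge0_ler_powR; rewrite ?nnegrE ?(ltW g0) ?(ltW e0) ?(ltW B0).
  - by rewrite /e gt_min ltr_pdivrMr// ltr_pMr// ltr1n.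
  - by rewrite -x0 ltW.
rewrite integral_nneseries//.
pose q := (2 `^ (g - D) : R)%R.
have q0 : (0 < q)%R by rewrite powR_gt0.
have q1 : (q < 1)%R by rewrite powR2_lt1// subr_lt0.
apply: (@le_trans _ _ (\sum_(j <oo) (C * 2 `^ g * r `^ (D - g) * q ^+ j)%:E)).
  apply: lee_nneseries => [j _ _|j _]; first by apply: integral_ge0.
  under eq_integral do rewrite EFinM.
  rewrite ge0_integralZl ?lee_fin ?powR_ge0//; last exact/measurable_EFinP.
  rewrite integral_indic// setIT.
  apply: (@le_trans _ _ (((r / 2 ^+ j.+1) `^ (- g))%:E * (C * (r / 2 ^+ j) `^ D)%:E)).
    by rewrite lee_wpmul2l ?lee_fin ?powR_ge0// mu_ball// divr_gt0 ?exprn_gt0.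
  rewrite -EFinM lee_fin le_eqVlt; apply/orP; left; apply/eqP.
  rewrite !powRM ?invr_ge0 ?exprn_ge0 ?(ltW r0)//.
  rewrite powRB ?gt_eqF ?implybT//.
  have pi k u : ((2 ^+ k)^-1 `^ u = (2 `^ (- u)) ^+ k :> R)%R.
    rewrite -(powR_invn k (ler0n R 2)) -(powR_mulrn k (powR_ge0 2 (- u))%R) -!powRrM.
    by congr (_ `^ _)%R; ring.
  rewrite !pi opprK exprS /q powRB ?pnatr_eq0 ?implybT//.
  rewrite exprMn exprVn [(2 `^ (- D))%R]powRN exprVn !powRN; ring.
rewrite /shell_const -/q.
have := @cvg_geometric_series R (C * 2 `^ g * r `^ (D - g))%R q.
rewrite ger0_norm ?(ltW q0)// => /(_ q1) cvgq.
rewrite (_ : (\sum_(j <oo) _) = ((C * 2 `^ g * r `^ (D - g)) / (1 - q))%:E).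
  by rewrite lee_fin le_eqVlt; apply/orP; left; apply/eqP; ring.
apply/cvg_lim => //.
rewrite (_ : (fun n => _) = EFin \o series (geometric (C * 2 `^ g * r `^ (D - g))%R q)).
  by apply: cvg_EFin => //; apply: nearW.
by apply/funext => k /=; rewrite sumEFin.
Qed.

End shells.

(** * Hoelder's inequality in additive form *)

Section young.
Context (R : realType).
Implicit Types (r N Y : R) (a A X : \bar R).

(** Either a <= N, or a = a^(1 - r) * a^r with a^(1 - r) <= N^(1 - r), as r > 1. *)
Lemma le_young_pow r N a : (1 < r)%R -> (0 < N)%R -> 0 <= a ->
  a <= N%:E + (N `^ (1 - r))%:E * a `^ r.
Proof.
move=> r1 N0; case: a => [a a0|_|//]; last first.
  by rewrite poweRyr ?gt_eqF ?(lt_trans _ r1)// gt0_muley ?lte_fin ?powR_gt0// addey.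
rewrite poweR_EFin -EFinM -EFinD lee_fin; rewrite lee_fin in a0.
have [aN|Na] := leP a N.
  by rewrite (le_trans aN)// lerDl mulr_ge0 ?powR_ge0.
have a_gt0 := lt_trans N0 Na.
apply: (@le_trans _ _ (N `^ (1 - r) * a `^ r)%R); last by rewrite lerDr ltW.
rewrite -[leLHS](powRr1 a0) -[in leLHS](subrK r 1%R) powRD; last by rewrite (gt_eqF a_gt0) implybT.
rewrite ler_wpM2r ?powR_ge0// -opprB !powRN lef_pV2 ?posrE ?powR_gt0//.
by apply: ge0_ler_powR; rewrite ?nnegrE ?subr_ge0; exact: ltW.
Qed.

(* Together with [le_young_pow] this replaces Hoelder's inequality; the choice
   is N = A / (2 Y). *)
Lemma pow_le_of_young r Y A X : (1 < r)%R -> (0 < Y)%R -> 0 <= A -> 0 <= X ->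
  (forall N, (0 < N)%R -> A <= (N * Y)%:E + (N `^ (1 - r))%:E * X) ->
  A `^ r <= (2 `^ r * Y `^ (r - 1))%:E * X.
Proof.
move=> r1 Y0; have c0 : (0 < 2 `^ r * Y `^ (r - 1))%R by rewrite mulr_gt0 ?powR_gt0.
move=> A0; case: X => [x|_ _|//]; last by rewrite gt0_muley ?lte_fin// leey.
move=> x0; case: A A0 => [a|_ /(_ 1%R ltr01)|//]; last by rewrite powR1 mul1e -EFinD leye_eq.
rewrite lee_fin in x0; rewrite lee_fin le_eqVlt => /predU1P[<-|a0] H.
  by rewrite poweR0r ?gt_eqF ?(lt_trans _ r1)// -EFinM lee_fin mulr_ge0// ltW.
rewrite poweR_EFin -EFinM lee_fin.
have a20 : (0 < a / 2)%R by rewrite divr_gt0.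
have := H (a / 2 / Y)%R; rewrite divfK ?gt_eqF// divr_gt0// => /(_ isT).
rewrite -EFinM -EFinD lee_fin -lerBlDl => H1.
have {}H1 : (a / 2 <= (a / 2 / Y) `^ (1 - r) * x)%R by apply: le_trans H1; lra.
have E : ((a / 2) `^ (r - 1) * ((a / 2 / Y) `^ (1 - r) * x) = Y `^ (r - 1) * x)%R.
  rewrite [((a / 2 / Y) `^ _)%R]powRM ?invr_ge0 ?(ltW a20) ?(ltW Y0)// 2!mulrA -powRD; last first.
    by rewrite (gt_eqF a20) implybT.
  rewrite (_ : r - 1 + (1 - r) = 0)%R; last by ring.
  rewrite powRr0 mul1r -powR_inv1 ?(ltW Y0)// -powRrM.
  by congr (_ `^ _ * _)%R; ring.
have {}H1 : ((a / 2) `^ r <= Y `^ (r - 1) * x)%R.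
  rewrite -E -(mulr_powRB1 (ltW a20) (lt_trans ltr01 r1)) mulrC.
  by rewrite ler_pM2l// powR_gt0.
rewrite -[a in leLHS](divfK (_ : 2%R != 0%R))// powRM ?(ltW a20)// mulrC -mulrA.
by rewrite ler_wpM2l ?powR_ge0.
Qed.

End young.

Section arith.
Context (R : realType).
Implicit Types a b e r : R.

(** In this and the next four lemmas [a] and [b] are stopping radii at two points and [e] is their
    distance; the inequalities with [+ e] express the Lipschitz property. *)
Lemma lt_half_of_quarter a b e : (0 < a)%R -> (e < a / 4)%R -> (a <= b + e)%R ->
  (e < b / 2)%R /\ (0 < b)%R.
Proof. by move=> *; split; lra. Qed.

Lemma le_double_of_quarter a b e : (0 < a)%R -> (e < a / 4)%R -> (b <= a + e)%R ->
  (b <= 2 * a)%R.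
Proof. by move=> *; lra. Qed.

Lemma le_of_lt_quarter a e : (0 < a)%R -> (e < a / 4)%R -> (e <= a)%R.
Proof. by move=> *; lra. Qed.

Lemma near_of_half a b e : (0 < a)%R -> (e < b / 2)%R -> (b <= a + e)%R ->
  (a <= b + e)%R -> (e < a)%R /\ (2 / 3 * a <= b)%R.
Proof. by move=> *; split; lra. Qed.

Lemma gt0_of_near a b e : (e < b / 2)%R -> (b <= a + e)%R -> (0 <= e)%R -> (0 < a)%R.
Proof. by move=> *; lra. Qed.

Lemma ler_powRN r a b : (0 <= r)%R -> (0 < a)%R -> (a <= b)%R ->
  (b `^ (- r) <= a `^ (- r))%R.
Proof.
move=> r0 a0 ab; have b0 := lt_le_trans a0 ab.
rewrite !powRN lef_pV2 ?posrE ?powR_gt0//.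
by apply: ge0_ler_powR; rewrite ?nnegrE//; exact: ltW.
Qed.

End arith.

(** * Potentials on Ahlfors regular spaces *)

HB.lock Definition ker (R : realType) (g r : R) : \bar R := xpow r%:E (- g).

Section kernel.
Context (R : realType) (g : R).
Hypothesis g0 : (0 < g)%R.
Local Notation ker := (ker g).

Lemma ker_ge0 r : 0 <= ker r. Proof. rewrite unlock; exact: xpow_ge0. Qed.

Lemma ker_EFin r : (0 < r)%R -> ker r = (r `^ (- g))%:E.
Proof. rewrite unlock; exact: xpow_EFin. Qed.

Lemma ker_nincr r r' : (0 <= r)%R -> (r <= r')%R -> ker r' <= ker r.
Proof. by rewrite unlock => r0 rr; apply: xpow_nincr; rewrite ?lee_fin// oppr_lt0. Qed.

Lemma ker_scale c r r' : (0 < c)%R -> (0 <= r')%R -> (r' <= c * r)%R ->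
  ker r <= (c `^ g)%:E * ker r'.
Proof.
move=> c0 r'0 rr.
rewrite (_ : (c `^ g)%:E * ker r' = ker (c^-1 * r')%R); last first.
  rewrite unlock EFinM xpowM ?invr_gt0//; congr (_%:E * _).
  by rewrite -powR_inv1 ?(ltW c0)// -powRrM mulrNN mul1r.
apply: ker_nincr; first by rewrite mulr_ge0// invr_ge0 ltW.
by rewrite ler_pdivrMl.
Qed.

Lemma ker_powR p r : (0 < p)%R -> (0 <= r)%R -> xpow r%:E (- (g * p)) = ker r `^ p.
Proof.
move=> p0; rewrite le_eqVlt => /predU1P[<-|r0]; rewrite unlock.
  by rewrite !xpow0 ?oppr_lt0 ?mulr_gt0// poweRyr// gt_eqF.
by rewrite !xpow_EFin// poweR_EFin -powRrM mulNr.
Qed.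

Lemma measurable_ker d (T : measurableType d) (h : T -> R) :
  measurable_fun [set: T] h -> (forall t, 0 <= h t)%R ->
  measurable_fun [set: T] (fun t => ker (h t)%R).
Proof.
rewrite unlock => mh h0; apply: measurable_xpow; first exact/measurable_EFinP.
by move=> t; rewrite lee_fin.
Qed.

End kernel.

Section ahlfors_regular.
Context d (T : measurableType d) (R : realType).
Variables (mu : {sigma_finite_measure set T -> \bar R}) (dist : T -> T -> R).
Variables (D Cu cl : R).
Hypothesis mdist : measurable_fun [set: T * T] (fun w : T * T => dist w.1 w.2).
Hypothesis dist_ge0 : forall x y, (0 <= dist x y)%R.
Hypothesis distC : forall x y, dist x y = dist y x.
Hypothesis dist_tri : forall y x z, (dist x z <= dist x y + dist y z)%R.
Hypotheses (Cu0 : (0 < Cu)%R) (cl0 : (0 < cl)%R).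
Hypothesis mu_ball_le : forall x r, (0 < r)%R ->
  mu [set y | (dist x y < r)%R] <= (Cu * r `^ D)%:E.
Hypothesis mu_ball_ge : forall x r, (0 < r)%R ->
  (cl * r `^ D)%:E <= mu [set y | (dist x y < r)%R].
Hypothesis D0 : (0 < D)%R.

Let mdistl x : measurable_fun [set: T] (dist x).
Proof. exact: (measurableT_comp mdist (measurable_pair1 x)). Qed.

Let mdistr x : measurable_fun [set: T] (dist ^~ x).
Proof. exact: (measurableT_comp mdist (measurable_pair2 x)). Qed.

Definition mball x (r : R) : set T := [set y | (dist x y < r)%R].

Lemma measurable_mball x r : measurable (mball x r).
Proof.
have := @measurable_fun_ltr _ _ _ setT _ _ (mdistl x) (measurable_cst r).
by move=> /(_ measurableT [set true] I); rewrite setTI.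
Qed.

(** One summand for each case of [ker_ball_integral]: z within 2 rho of the centre, and z farther
    away. *)
Definition ball_const (g : R) : R :=
  (Cu * shell_const D g * 3 `^ (D - g) * 4 `^ g + Cu * 4 `^ g)%R.

Lemma ball_const_gt0 (g : R) : (g < D)%R -> (0 < ball_const g)%R.
Proof.
move=> gD; rewrite addr_gt0//; last by rewrite mulr_gt0// powR_gt0.
by do 3 (apply: mulr_gt0; rewrite ?powR_gt0//); exact: shell_const_gt0.
Qed.

(** For z near y, the ball lies in the one of radius 3 rho about z, where the kernel is integrable
    as g < D; for z far from y, the kernel is nearly constant on the ball. The shift 2 rho exceeds
    rho so that, for rho = [stop y], the potential with this shift is at most t. *)
Lemma ker_ball_integral (g : R) (g0 : (0 < g)%R) (gD : (g < D)%R) y z (rho : R) :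
  (0 < rho)%R ->
  \int[mu]_(x in mball y (rho / 2)%R) ker g (dist x z) <=
  (ball_const g * rho `^ D)%:E * ker g (2 * rho + dist y z)%R.
Proof.
rewrite /ball_const; set S := (Cu * shell_const D g * 3 `^ (D - g) * 4 `^ g)%R.
have S0 : (0 <= S)%R.
  by do 3 (apply: mulr_ge0; rewrite ?powR_ge0 ?(ltW Cu0) //); exact: ltW (shell_const_gt0 gD).
move=> rho0.
have mk : measurable_fun [set: T] (fun x => ker g (dist x z)) by exact: measurable_ker.
have K0 := ker_ge0 g (2 * rho + dist y z)%R.
case: (leP (dist y z) (2 * rho)%R) => yz.
- apply: (@le_trans _ _ ((S * rho `^ D)%:E * ker g (2 * rho + dist y z)%R)); last first.
    by rewrite lee_wpmul2r// lee_fin ler_wpM2r ?powR_ge0// lerDl mulr_ge0 ?powR_ge0// ltW.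
  apply: (@le_trans _ _ (\int[mu]_(x in mball z (3 * rho)%R) ker g (dist z x))).
    rewrite [leRHS](eq_integral (fun x => ker g (dist x z))); last first.
      by move=> x _; rewrite distC.
    apply: ge0_subset_integral; [exact: measurable_mball..| | |].
    - exact: measurable_funTS.
    - by move=> x _; exact: ker_ge0.
    - move=> x; rewrite /mball/= => xy; have := dist_tri y z x; rewrite (distC z y); lra.
  have h3 : (0 < 3 * rho)%R by rewrite mulr_gt0.
  have h4 : (0 < 4 * rho)%R by rewrite mulr_gt0.
  apply: (@le_trans _ _ (Cu * shell_const D g * (3 * rho) `^ (D - g))%:E).
    by rewrite unlock; exact: (integral_shell (mdistl z) (dist_ge0 z) g0 gD (mu_ball_le z) h3).
  apply: (@le_trans _ _ ((S * rho `^ D)%:E * ker g (4 * rho)%R)); last first.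
    rewrite lee_wpmul2l ?lee_fin ?(mulr_ge0 S0) ?powR_ge0//.
    by apply: ker_nincr; [|rewrite addr_ge0 ?mulr_ge0 ?(ltW rho0)|lra].
  rewrite ker_EFin// -EFinM lee_fin le_eqVlt; apply/orP; left; apply/eqP.
  rewrite /S !powRM ?(ltW rho0)// powRB ?gt_eqF ?implybT//.
  have h : (rho `^ (D - g) = rho `^ D * rho `^ (- g))%R.
    by rewrite -powRD// (gt_eqF rho0) implybT.
  rewrite h; have : (4 `^ g * 4 `^ (- g) = 1 :> R)%R.
    by rewrite -powRD ?subrr ?powRr0// pnatr_eq0 implybT.
  set a := (4 `^ g)%R; set b := (4 `^ (- g))%R => ab.
  by rewrite -[LHS]mulr1 -ab; ring.
- have yz0 : (0 < dist y z)%R by apply: lt_trans yz; rewrite mulr_gt0.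
  apply: (@le_trans _ _ ((Cu * 4 `^ g * rho `^ D)%:E * ker g (2 * rho + dist y z)%R)); last first.
    by rewrite lee_wpmul2r// lee_fin ler_wpM2r ?powR_ge0// lerDr.
  rewrite -mulrA (mulrC (4 `^ g)%R) mulrA EFinM -muleA [X in _ <= X]muleC.
  set K := _%:E * ker g _.
  apply: (@le_trans _ _ (\int[mu]_(x in mball y (rho / 2)%R) cst K x)).
    apply: ge0_le_integral; first exact: measurable_mball.
    - by move=> x _; exact: ker_ge0.
    - exact: measurable_funTS.
    - exact: measurable_cst.
    - move=> x xy; apply: ker_scale => //; first by rewrite addr_ge0 ?mulr_ge0 ?(ltW rho0).
      have := dist_tri x y z; rewrite /mball/= in xy; lra.
  rewrite [leLHS](integral_cst mu (measurable_mball y (rho / 2)%R) K).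
  rewrite lee_wpmul2l//; first by rewrite /K mule_ge0// ?ker_ge0 ?lee_fin ?powR_ge0.
  apply: le_trans (mu_ball_le _ _) _; first by rewrite divr_gt0.
  rewrite lee_fin ler_wpM2l ?(ltW Cu0)// ge0_ler_powR ?nnegrE ?(ltW D0) ?divr_ge0 ?(ltW rho0)//.
  lra.
Qed.

Section potential.
Variable g : R.
Hypothesis g0 : (0 < g)%R.
Local Notation ker := (ker g).
Variable f : T -> \bar R.
Hypothesis mf : measurable_fun [set: T] f.
Hypothesis f0 : forall x, 0 <= f x.
Implicit Types (x y z : T) (r : R).

Definition pot r x : \bar R :=
  \int[mu]_z (ker (r + dist x z)%R * f z).

Lemma pot_ge0 r x : 0 <= pot r x.
Proof. by apply: integral_ge0 => z _; rewrite mule_ge0// ker_ge0. Qed.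

Lemma measurable_ker_shift r x : (0 <= r)%R ->
  measurable_fun [set: T] (fun z => ker (r + dist x z)%R).
Proof.
move=> r0; apply: measurable_ker; last by move=> z; rewrite addr_ge0 ?dist_ge0.
by apply: measurable_funD => //; exact: mdistl.
Qed.

Lemma measurable_pot_integrand r x : (0 <= r)%R ->
  measurable_fun [set: T] (fun z => ker (r + dist x z)%R * f z).
Proof. by move=> r0; apply: emeasurable_funM => //; exact: measurable_ker_shift. Qed.

Lemma measurable_pot r : (0 <= r)%R -> measurable_fun [set: T] (pot r).
Proof.
move=> r0.
apply: (@measurable_fun_fubini_tonelli_F _ _ T T R mu
  (fun w : T * T => ker (r + dist w.1 w.2)%R * f w.2)).
  by apply: emeasurable_funM; [apply: measurable_ker => //; [apply: measurable_funD => //; exact: mdist|move=> t; rewrite addr_ge0 ?dist_ge0]|exact: measurableT_comp].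
by move=> w; rewrite mule_ge0// ker_ge0.
Qed.

Lemma pot_scale c r r' x x' : (0 < c)%R -> (0 <= r)%R -> (0 <= r')%R ->
  (forall z, r + dist x z <= c * (r' + dist x' z))%R ->
  pot r' x' <= (c `^ g)%:E * pot r x.
Proof.
move=> c0 r0 r'0 h; rewrite /pot -ge0_integralZl//; last 3 first.
- exact: measurable_pot_integrand.
- by move=> z _; rewrite mule_ge0// ker_ge0.
- by rewrite lee_fin powR_ge0.
apply: ge0_le_integral => //.
- by move=> z _; rewrite mule_ge0// ker_ge0.
- exact: measurable_pot_integrand.
- by apply: emeasurable_funM => //; exact: measurable_pot_integrand.
- by move=> z _; rewrite muleA lee_wpmul2r// ker_scale// addr_ge0.
Qed.

Lemma pot_mono r r' x x' : (0 <= r)%R -> (0 <= r')%R ->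
  (forall z, r + dist x z <= r' + dist x' z)%R -> pot r' x' <= pot r x.
Proof.
move=> r0 r'0 h; apply: (le_trans (@pot_scale 1%R r r' x x' _ _ _ _)) => //.
  by move=> z; rewrite mul1r.
by rewrite powR1 mul1e.
Qed.

(** This bounds the stopping radius. Dominated convergence along r0 + k applies: the integrand at r0
    is integrable and its kernel is positive, so f is finite almost everywhere. *)
Lemma pot_vanish (r0 t : R) x : (0 < r0)%R -> pot r0 x < +oo -> (0 < t)%R ->
  exists2 r, (0 < r)%R & pot r x <= t%:E.
Proof.
move=> r00 fin t0.
pose h z := ker (r0 + dist x z)%R * f z.
have ih : mu.-integrable [set: T] h.
  apply/integrableP; split; first by apply: measurable_pot_integrand; exact: ltW.
  by under eq_integral do rewrite gee0_abs ?mule_ge0 ?ker_ge0//.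
have kpos k z : (0 < r0 + k%:R + dist x z)%R by rewrite ltr_wpDr ?dist_ge0// ltr_wpDr.
have kpos0 z : (0 < r0 + dist x z)%R by rewrite ltr_wpDr ?dist_ge0.
have r0k k : (0 <= r0 + k%:R)%R by rewrite addr_ge0 ?dist_ge0// ltW.
have := @dominated_convergence _ T R mu setT measurableT
  (fun k z => ker (r0 + k%:R + dist x z)%R * f z) (cst 0) h.
case => //.
- by move=> k; exact: measurable_pot_integrand.
- have [N [mN N0 sN]] := integrable_ae measurableT ih.
  exists N; split => // z /= nz; apply: sN => /= /(_ I) hfin; apply: nz => _.
  have : f z \is a fin_num.
    move: hfin; rewrite /h ker_EFin//; case: (f z) (f0 z) => // _.
    by rewrite gt0_muley// lte_fin powR_gt0.
  case: (f z) (f0 z) => // c c0 _.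
  under eq_fun do rewrite ker_EFin// -EFinM.
  apply: cvg_EFin; first exact: nearW.
  rewrite -[X in _ --> X](mul0r c).
  apply: cvgMl; apply/cvgr0Pnorm_le => e e0.
  near=> k; rewrite ger0_norm ?powR_ge0//.
  have e1 : (0 < e `^ (- g^-1))%R by rewrite powR_gt0.
  rewrite [leRHS](_ : e = ((e `^ (- g^-1)) `^ (- g))%R); last first.
    by rewrite -powRrM mulrNN mulVf ?gt_eqF// powRr1// ltW.
  have eB : (e `^ (- g^-1) <= r0 + k%:R + dist x z)%R.
    apply: (@le_trans _ _ k%:R); last by rewrite addrAC lerDr addr_ge0// ltW.
    near: k; exact: nbhs_infty_ger.
  move: (e `^ (- g^-1))%R e1 eB => B B0 eB.
  rewrite !powRN lef_pV2 ?posrE ?powR_gt0//.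
  by apply: ge0_ler_powR; rewrite ?nnegrE//; exact: ltW.
- apply: aeW => z k _; rewrite gee0_abs ?mule_ge0 ?ker_ge0//.
  rewrite lee_wpmul2r// ker_nincr// ?(ltW (kpos0 _))//.
  by rewrite lerD2r lerDl.
move=> _ _; rewrite integral0 => cvg0.
have : \forall k \near \oo, pot (r0 + k%:R) x < t%:E.
  by apply: (cvg0 [set y : \bar R | y < t%:E]); apply: (@open_ereal_lt' _ 0 t%:E); rewrite lte_fin.
case=> k _ /(_ k (leqnn _)) /ltW ?; exists (r0 + k%:R)%R => //.
by rewrite ltr_wpDr ?dist_ge0.
Unshelve. all: end_near. Qed.

(** Where dist x z >= r one has r + dist x z <= 2 dist x z, which costs the factor 2^g; as r
    decreases to 0 these sets exhaust the complement of a null set. *)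
Lemma pot_sup x (t : R) : (forall r, (0 < r)%R -> pot r x <= t%:E) ->
  pot 0 x <= (2 `^ g * t)%:E.
Proof.
move=> ht.
pose F k : set T := [set z : T | (k.+1%:R^-1 <= dist x z)%R].
have mF k : measurable (F k).
  rewrite (_ : F k = ~` mball x k.+1%:R^-1); last first.
    by apply/seteqP; split => z /=; rewrite /F/mball/= leNgt => /negP.
  by apply: measurableC; exact: measurable_mball.
have m0 := @measurable_pot_integrand 0 x (lexx _).
have ndF : nondecreasing_seq F.
  move=> i j ij; apply/subsetPset => z; apply: le_trans.
  by rewrite lef_pV2 ?posrE// ler_nat.
pose Z : set T := [set z | dist x z = 0%R].
have UF : \bigcup_k F k = setT `\` Z.
  apply/seteqP; split => z /=.
    move=> [k _ Fk]; split=> // zx; move: Fk; rewrite /F/= zx.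
    by rewrite leNgt invr_gt0 ltr0n.
  move=> [_ zx]; have d0 : (0 < dist x z)%R.
    by rewrite lt_neqAle dist_ge0 andbT eq_sym; apply/eqP.
  exists (Num.trunc ((dist x z)^-1)%R) => //; rewrite /F/=.
  rewrite invf_ple ?posrE//; exact/ltW/truncnS_gt.
have mZ : measurable Z.
  rewrite -[X in measurable X]setCK; apply: measurableC.
  by rewrite -setTD -UF; exact: bigcup_measurable.
(* [dist x] may vanish away from x, but the balls about x shrink to measure 0. *)
have nul : mu Z = 0.
  apply/eqP; rewrite eq_le measure_ge0 andbT; apply/lee_addgt0Pr => e e0.
  rewrite add0e; pose r := ((e / Cu) `^ D^-1)%R.
  have r0 : (0 < r)%R by rewrite powR_gt0// divr_gt0.
  apply: (@le_trans _ _ (mu (mball x r))).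
    rewrite le_measure ?inE//; first exact: measurable_mball.
    by move=> z; rewrite /Z/mball/= => ->.
  apply: (le_trans (mu_ball_le _ r0)); rewrite lee_fin /r.
  rewrite -powRrM mulVf ?gt_eqF// powRr1; last by rewrite divr_ge0 ?ltW.
  by rewrite mulrC divfK ?gt_eqF.
rewrite /pot (@ge0_negligible_integral _ _ _ _ setT Z)//; last first.
  by move=> z _; rewrite mule_ge0// ker_ge0.
rewrite -UF.
have cvgF := @ge0_nondecreasing_set_cvg_integral _ _ _ F
  (fun z => ker (0 + dist x z)%R * f z) mu ndF mF
  (fun k => measurable_funTS m0) (fun k z _ => mule_ge0 (ker_ge0 _ _) (f0 z)).
rewrite -(cvg_lim _ cvgF)//; apply: lime_le; first by apply/cvg_ex; eexists; exact: cvgF.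
apply: nearW => k.
apply: (@le_trans _ _ (\int[mu]_z ((2 `^ g)%:E * (ker (k.+1%:R^-1 + dist x z)%R * f z)))).
  rewrite integral_mkcond; apply: ge0_le_integral => //.
  - by move=> z _; apply: erestrict_ge0 => y _; rewrite mule_ge0// ker_ge0.
  - apply/(measurable_restrictT _ _).1 => //; exact: measurable_funTS.
  - by apply: emeasurable_funM => //; apply: measurable_pot_integrand; rewrite invr_ge0.
  move=> z _; rewrite patchE; case: ifPn => [|_]; last first.
    by rewrite !mule_ge0 ?ker_ge0// lee_fin powR_ge0.
  rewrite inE /F/= => Fz; rewrite muleA lee_wpmul2r//.
  apply: ker_scale => //; first by rewrite addr_ge0 ?dist_ge0// invr_ge0.
  by rewrite add0r mulr_natl mulr2n lerD2r.
rewrite ge0_integralZl//; last 2 first.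
- by apply: measurable_pot_integrand; rewrite invr_ge0.
- by move=> z _; rewrite mule_ge0// ker_ge0.
by rewrite EFinM lee_wpmul2l ?lee_fin ?powR_ge0// ht// invr_gt0.
Qed.

(** * The stopping radius and the test function of a level *)

Section stopping_radius.
Hypothesis pot_fin : exists x0 r0, (0 < r0)%R /\ pot r0 x0 < +oo.
Variable t : R.
Hypothesis t0 : (0 < t)%R.

Let S x : set R := [set r | (0 < r)%R /\ t%:E < pot r x].

(** The supremum of the empty set is 0, which is the value where no shift r > 0 has potential above
    t. *)
Definition stop x : R := sup (S x).

(** A bound at the one point x0 transfers to x when r grows by [dist x x0]. *)
Let S_ub x : exists M, ubound (S x) M.
Proof.
have [x0 [r0 [r00 pot_fin0]]] := pot_fin.
have [r1 r10 r1t] := pot_vanish r00 pot_fin0 t0.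
exists (r1 + dist x x0)%R => r [r_gt0 tr]; rewrite leNgt; apply/negP => rr.
move: tr; apply/negP; rewrite -leNgt (le_trans _ r1t)//.
apply: pot_mono; rewrite ?(ltW r10) ?(ltW r_gt0)// => z.
have := dist_tri x x0 z; rewrite (distC x0 x); lra.
Qed.

Lemma pot_le_stop x r : (0 < r)%R -> (stop x < r)%R -> pot r x <= t%:E.
Proof.
move=> r_gt0 sr; rewrite leNgt; apply/negP => tr.
have := ub_le_sup (S_ub x) (conj r_gt0 tr); rewrite -/(stop x).
by rewrite leNgt sr.
Qed.

Lemma lt_pot_stop x r : (0 < r)%R -> (r < stop x)%R -> t%:E < pot r x.
Proof.
move=> r_gt0 rs.
have S0 : S x !=set0.
  apply/set0P/negP => /eqP S0; move: rs; rewrite /stop S0 sup0 => /(lt_trans r_gt0).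
  by rewrite ltxx.
have [r' [r'0 tr'] rr'] := sup_gt S0 rs.
apply: (lt_le_trans tr'); apply: pot_mono; rewrite ?(ltW r_gt0) ?(ltW r'0)// => z.
by rewrite lerD2r ltW.
Qed.

Lemma stop_ge0 x : (0 <= stop x)%R.
Proof.
rewrite leNgt; apply/negP => s0.
have S0 : S x !=set0.
  by apply/set0P/negP => /eqP S0; move: s0; rewrite /stop S0 sup0 ltxx.
case: S0 => r [r_gt0 tr]; have := ub_le_sup (S_ub x) (conj r_gt0 tr).
by rewrite -/(stop x) leNgt (lt_trans s0).
Qed.

(** Moving from x to y while lowering r by [dist x y] does not decrease the potential. A shift r
    midway between the two sides of a failing inequality then contradicts the choice of [stop y]. *)
Lemma stop_lipschitz x y : (stop x <= stop y + dist x y)%R.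
Proof.
rewrite leNgt; apply/negP => h.
have [h1 h2] := midf_lt h; set r := (_ / 2)%R in h1 h2.
have h3 : (stop y < r - dist x y)%R by rewrite ltrBrDr.
have rxy : (0 < r - dist x y)%R by exact: le_lt_trans (stop_ge0 y) h3.
have r_gt0 : (0 < r)%R by apply: (lt_le_trans rxy); rewrite gerBl.
have : t%:E < pot r x by exact: lt_pot_stop.
apply/negP; rewrite -leNgt.
apply: (@le_trans _ _ (pot (r - dist x y)%R y)); last exact: pot_le_stop.
apply: pot_mono => [||z]; [exact: ltW|exact: ltW|].
by rewrite -addrA lerD2l addrC lerBlDl (distC x y) dist_tri.
Qed.

Lemma lt_pot0_stop x : (0 < stop x)%R -> t%:E < pot 0 x.
Proof.
move=> s0; have h : (0 < stop x / 2 < stop x)%R by apply/andP; split; lra.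
case/andP: h => h1 h2.
apply: (lt_le_trans (lt_pot_stop h1 h2)); apply: pot_mono => //; first exact: ltW.
by move=> z; rewrite lerD2r ltW.
Qed.

Lemma pot0_le_stop x : stop x = 0%R -> pot 0 x <= (2 `^ g * t)%:E.
Proof. by move=> s0; apply: pot_sup => r r_gt0; apply: pot_le_stop; rewrite ?s0. Qed.

(** Sets open for [dist] are not known to be measurable, so the Lipschitz bound does not give this.
    For a >= 0, {stop > a} is instead a countable union of superlevel sets of potentials with shifts
    above a. *)
Lemma measurable_stop : measurable_fun [set: T] stop.
Proof.
move=> mT; apply: (measurability _ (RGenOInfty.measurableE R)) => //.
move=> _ [_ [a ->] <-]; rewrite setTI.
have [a0|a0] := ltP a 0%R.
  rewrite (_ : _ @^-1` _ = setT)//; apply/seteqP; split => // x _ /=.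
  by rewrite in_itv/= andbT (lt_le_trans a0)// stop_ge0.
rewrite (_ : _ @^-1` _ = \bigcup_k [set x | t%:E < pot (a + k.+1%:R^-1)%R x]).
  apply: bigcup_measurable => k _.
  have ak : (0 <= a + k.+1%:R^-1)%R by rewrite addr_ge0// invr_ge0.
  have := @measurable_fun_lte _ _ _ setT _ _ (measurable_cst t%:E) (measurable_pot ak).
  by move=> /(_ measurableT [set true] I); rewrite setTI.
apply/seteqP; split => x /=; rewrite in_itv/= andbT.
- move=> h; pose e := (stop x - a)%R; have e0 : (0 < e)%R by rewrite subr_gt0.
  exists (Num.trunc e^-1) => //=; apply: lt_pot_stop.
    by rewrite ltr_wpDl// invr_gt0.
  rewrite -ltrBrDl -/e invf_plt ?posrE//; exact: truncnS_gt.
- move=> [k _ /= h]; have ak : (0 < a + k.+1%:R^-1)%R by rewrite ltr_wpDl// invr_gt0.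
  have /(ub_le_sup (S_ub x)) : S x (a + k.+1%:R^-1)%R by [].
  by rewrite -/(stop x); apply: lt_le_trans; rewrite ltrDl invr_gt0.
Qed.

(** Chosen so that 2^g * [low] = t / 2, the loss allowed in [pot_low_le]. *)
Definition low : R := (t / (2 * 2 `^ g))%R.

Let low0 : (0 < low)%R. Proof. by rewrite divr_gt0// mulr_gt0// powR_gt0. Qed.

Let low_lt : (low < t)%R.
Proof.
rewrite ltr_pdivrMr ?mulr_gt0 ?powR_gt0// ltr_pMr//.
have : (1 <= 2 `^ g :> R)%R by rewrite -[leLHS](powRr0 2) ler_powR ?ler1n// ltW.
lra.
Qed.

Let mpot0 : measurable_fun [set: T] (pot 0) := measurable_pot (lexx 0%R).

(** stop y^(-D) stands for the inverse measure of the ball. As [powR] sends 0 to 0 for negative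
    exponents, [avg] is 0 where [stop] is 0. *)
Definition avg y : \bar R := (stop y `^ (- D))%:E *
  \int[mu]_z (if (dist y z < stop y / 2)%R then f z else 0).

Definition test y : \bar R :=
  if (0 < stop y)%R then avg y else if low%:E < pot 0 y then f y else 0.

Let measurable_near : measurable_fun [set: T * T]
  (fun w : T * T => (dist w.1 w.2 < stop w.1 / 2)%R).
Proof.
apply: measurable_fun_ltr => //; apply: measurable_funM => //.
exact: (measurableT_comp measurable_stop measurable_fst).
Qed.

Let measurable_low : measurable_fun [set: T] (fun z => low%:E < pot 0 z).
Proof. exact: measurable_fun_lte. Qed.

Let measurable_stop_gt0 : measurable_fun [set: T] (fun z => (0 < stop z)%R).
Proof. by apply: measurable_fun_ltr => //; exact: measurable_stop. Qed.

Lemma avg_ge0 y : 0 <= avg y.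
Proof.
by rewrite mule_ge0 ?lee_fin ?powR_ge0// integral_ge0// => z _; case: ifP.
Qed.

Lemma measurable_avg : measurable_fun [set: T] avg.
Proof.
apply: emeasurable_funM.
  apply/measurable_EFinP.
  exact: (measurableT_comp (measurable_powR (- D)%R) measurable_stop).
apply: (@measurable_fun_fubini_tonelli_F _ _ T T R mu (fun w : T * T =>
   if (dist w.1 w.2 < stop w.1 / 2)%R then f w.2 else 0)).
  by apply: measurable_fun_ifT => //; exact: (measurableT_comp mf measurable_snd).
by move=> w; case: ifP.
Qed.

Lemma test_ge0 y : 0 <= test y.
Proof. by rewrite /test; case: ifP => _; [exact: avg_ge0|case: ifP]. Qed.

Lemma measurable_test : measurable_fun [set: T] test.
Proof.
apply: measurable_fun_ifT => //; first exact: measurable_avg.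
exact: measurable_fun_ifT.
Qed.

(* Boundedness principle: compare with the potential at a point x' of
   {pot 0 <= low} almost closest to x, for which |x' - z| <= 2 (r + |x - z|)
   whenever z lies in that set. *)
Lemma pot_low_le r x : (0 < r)%R ->
  \int[mu]_z (if low%:E < pot 0 z then 0 else ker (r + dist x z)%R * f z) <=
  (t / 2)%:E.
Proof.
move=> r_gt0.
have [[x1 x1low]|nolow] := pselect (exists x1, pot 0 x1 <= low%:E); last first.
  rewrite integral0_eq ?lee_fin ?divr_ge0 ?(ltW t0)// => z _.
  by case: ltP => // zl; case: nolow; exists z.
pose E : set R := [set dist x z | z in [set z | pot 0 z <= low%:E]].
have Elb : has_lbound E by exists 0%R => _ [z _ <-].
have [_ [x' x'low <-] x'E] : exists2 e, E e & (e < inf E + r)%R.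
  by apply: inf_adherent => //; split => //; exists (dist x x1); exists x1.
apply: (@le_trans _ _ ((2 `^ g)%:E * pot 0 x')); last first.
  apply: (@le_trans _ _ ((2 `^ g)%:E * low%:E)).
    by rewrite lee_wpmul2l// lee_fin powR_ge0.
  rewrite -EFinM lee_fin /low.
  have h : (2 `^ g != 0 :> R)%R by rewrite gt_eqF ?powR_gt0.
  move: (2 `^ g)%R h => u h; rewrite le_eqVlt; apply/orP; left; apply/eqP; field.
  by rewrite h.
rewrite /pot -ge0_integralZl//; last 2 first.
- exact: measurable_pot_integrand.
- by move=> z _; rewrite mule_ge0// ker_ge0.
apply: ge0_le_integral => //.
- by move=> z _; case: ifP => // _; rewrite mule_ge0// ker_ge0.
- by apply: measurable_fun_ifT => //; apply: measurable_pot_integrand; exact: ltW.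
- by apply: emeasurable_funM => //; exact: measurable_pot_integrand.
move=> z _; case: ltP => [_|zlow].
  by rewrite !mule_ge0 ?ker_ge0// lee_fin powR_ge0.
rewrite muleA lee_wpmul2r// ker_scale//; first by rewrite addr_ge0.
rewrite add0r.
have h1 : (inf E <= dist x z)%R by apply: ge_inf => //; exists z.
have := dist_tri x x' z; rewrite (distC x' x); lra.
Qed.

(** The minimum covers the points with [stop] zero, of weight 1, and those of [Psi_integral_ge]. The
    2 comes from the half of t lost in [pot_low_le], and 2^g from a change of shift in the
    kernel. *)
Definition test_const : R := (Num.min 1 (cl * 8 `^ (- D)) / (2 * 2 `^ g))%R.

Lemma test_const_gt0 : (0 < test_const)%R.
Proof.
by rewrite divr_gt0 ?mulr_gt0 ?powR_gt0// lt_min ltr01 mulr_gt0 ?powR_gt0.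
Qed.

(** Its integral in z is the integrand of the potential of [avg]; its integral in y is the share of
    z in that potential. *)
Let Psi x y z : \bar R :=
  if (dist y z < stop y / 2)%R then ker (dist x y) * (stop y `^ (- D))%:E * f z else 0.

Let Psi_ge0 x y z : 0 <= Psi x y z.
Proof. by rewrite /Psi; case: ifP => // _; rewrite !mule_ge0 ?ker_ge0 ?lee_fin ?powR_ge0. Qed.

Let measurable_Psi x : measurable_fun [set: T * T] (fun w : T * T => Psi x w.1 w.2).
Proof.
apply: measurable_fun_ifT => //; apply: emeasurable_funM.
  apply: emeasurable_funM.
    apply: measurable_ker => //.
    exact: (measurableT_comp (mdistl x) measurable_fst).
  apply/measurable_EFinP.
  apply: (measurableT_comp (measurable_powR (- D)%R)).
  exact: (measurableT_comp measurable_stop measurable_fst).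
exact: (measurableT_comp mf measurable_snd).
Qed.

Let integral_PsiE x y : \int[mu]_z Psi x y z = ker (dist x y) * avg y.
Proof.
rewrite /avg muleA -ge0_integralZl//; last 3 first.
- apply: measurable_fun_ifT => //.
  by apply: measurable_fun_ltr => //; exact: mdistl.
- by move=> z _; case: ifP.
- by rewrite mule_ge0 ?ker_ge0// lee_fin powR_ge0.
by apply: eq_integral => z _; rewrite /Psi; case: ifP => // _; rewrite mule0.
Qed.

Let avg_stop0 y : stop y = 0%R -> avg y = 0.
Proof. by move=> s0; rewrite /avg s0 powR0 ?mul0e// oppr_eq0 gt_eqF. Qed.

(* It is enough to keep the y with dist z y < stop z / 4: there stop y and
   stop z are comparable, stop being 1-Lipschitz. *)
Let Psi_integral_ge x z : (0 < stop z)%R ->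
  (cl * 8 `^ (- D))%:E * (ker (stop z + dist x z)%R * f z) <= \int[mu]_y Psi x y z.
Proof.
move=> sz.
set K := ker (stop z + dist x z)%R * f z.
have K0 : 0 <= K by rewrite mule_ge0 ?ker_ge0.
have c0 : 0 <= ((2 * stop z) `^ (- D))%:E by rewrite lee_fin powR_ge0.
have sz4 : (0 < stop z / 4)%R by rewrite divr_gt0.
(* 8 = 2 * 4: stop y <= 2 stop z, and the ball has radius stop z / 4. *)
apply: (@le_trans _ _ (((2 * stop z) `^ (- D))%:E * K * mu (mball z (stop z / 4)%R))).
  apply: (@le_trans _ _ (((2 * stop z) `^ (- D))%:E * K * (cl * (stop z / 4) `^ D)%:E)).
    rewrite muleAC -EFinM lee_wpmul2r// lee_fin le_eqVlt; apply/orP; left; apply/eqP.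
    rewrite !powRM ?(ltW sz)// [in RHS]mulrCA; congr (_ * _)%R.
    rewrite (_ : 8 = 2 * 4)%R; last by ring.
    rewrite powRM// -(powR_inv1 (ler0n R 4)) -powRrM mulN1r.
    rewrite -!mulrA; congr (_ * _)%R; rewrite mulrA -powRD; last first.
      by rewrite (gt_eqF sz) implybT.
    by rewrite addNr powRr0 mul1r.
  by apply: lee_wpmul2l; [exact: mule_ge0|apply: mu_ball_ge].
rewrite -(integral_cst mu (measurable_mball z (stop z / 4)%R)).
rewrite integral_mkcond; apply: ge0_le_integral => //.
- by move=> y _; apply: erestrict_ge0 => w _; rewrite /= mule_ge0.
- by apply/(measurable_restrictT _ _).1 => //; exact: measurable_mball.
- exact: (measurableT_comp (measurable_Psi x) (measurable_pair2 z)).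
move=> y _; rewrite patchE; case: ifPn => [|_]; last exact: Psi_ge0.
rewrite inE /mball/= => zy.
have h1 := stop_lipschitz z y; have h2 := stop_lipschitz y z.
rewrite (distC y z) in h2; have [zy2 sy] := lt_half_of_quarter sz zy h1.
rewrite /Psi distC zy2.
rewrite muleA lee_wpmul2r// muleC; apply: lee_pmul => //; first exact: ker_ge0.
  apply: ker_nincr; [exact: g0|exact: dist_ge0|].
  apply: le_trans (dist_tri z x y) _; rewrite addrC lerD2r.
  exact: le_of_lt_quarter zy.
rewrite lee_fin; apply: ler_powRN; [exact: ltW|exact: sy|].
exact: le_double_of_quarter h2.
Qed.

(** The argument works at shift stop x / 2, where the potential still exceeds t. By Tonelli, each z
    with [pot 0 z] above [low] contributes to the potential of [test] at least a multiple of what it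
    contributes at that shift. *)
Lemma pot_test_ge x : (2 `^ g * t)%:E < pot 0 x ->
  (test_const * t)%:E <= \int[mu]_y (ker (dist x y) * test y).
Proof.
move=> tx.
have sx : (0 < stop x)%R.
  rewrite lt_neqAle stop_ge0 andbT eq_sym; apply/eqP => /pot0_le_stop.
  by rewrite leNgt tx.
have sx2 : (0 < stop x / 2)%R by rewrite divr_gt0.
have sx2x : (stop x / 2 < stop x)%R by rewrite gtr_pMr// invf_lt1// ltr1n.
pose kap := Num.min 1%R (cl * 8 `^ (- D))%R.
have kap0 : (0 <= kap)%R by rewrite le_min ler01 mulr_ge0 ?powR_ge0 ?(ltW cl0).
pose H r z := if low%:E < pot 0 z then ker (r + dist x z)%R * f z else 0.
have mH r : (0 <= r)%R -> measurable_fun [set: T] (H r).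
  by move=> r_ge0; apply: measurable_fun_ifT => //; exact: measurable_pot_integrand.
have H0 r z : 0 <= H r z.
  by rewrite /H; case: ifP => // _; rewrite mule_ge0// ker_ge0.
have Hpot : (t / 2)%:E <= \int[mu]_z H (stop x / 2)%R z.
  have := lt_pot_stop sx2 sx2x.
  have -> : pot (stop x / 2)%R x = \int[mu]_z H (stop x / 2)%R z +
     \int[mu]_z (if low%:E < pot 0 z then 0 else ker (stop x / 2 + dist x z)%R * f z).
    rewrite -ge0_integralD//.
    - by apply: eq_integral => z _; rewrite /H; case: ifP => _; rewrite ?adde0 ?add0e.
    - exact/mH/ltW.
    - by move=> z _; case: ifP => // _; rewrite mule_ge0// ker_ge0.
    - by apply: measurable_fun_ifT => //; apply: measurable_pot_integrand; exact: ltW.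
  have := pot_low_le x sx2 => h1 h2; rewrite leNgt; apply/negP => h3.
  move: h2; apply/negP; rewrite -leNgt.
  apply: (@le_trans _ _ ((t / 2)%:E + (t / 2)%:E)); first by apply: leeD => //; exact: ltW.
  by rewrite -EFinD -splitr.
pose B y : \bar R := ker (dist x y) *
  (if (0 < stop y)%R then 0 else if low%:E < pot 0 y then f y else 0).
have mB : measurable_fun [set: T] B.
  apply: emeasurable_funM; first by apply: measurable_ker => //; exact: mdistl.
  by apply: measurable_fun_ifT => //; exact: measurable_fun_ifT.
have B0 y : 0 <= B y by rewrite /B mule_ge0 ?ker_ge0//; case: ifP => // _; case: ifP.
have mP1 : measurable_fun [set: T] (fun y => \int[mu]_z Psi x y z).
  exact: (@measurable_fun_fubini_tonelli_F _ _ T T R mu (fun w => Psi x w.1 w.2)).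
have mP2 : measurable_fun [set: T] (fun z => \int[mu]_y Psi x y z).
  exact: (@measurable_fun_fubini_tonelli_G _ _ T T R mu (fun w => Psi x w.1 w.2)).
have iP0 (F : T -> \bar R) : (forall y, 0 <= F y) -> 0 <= \int[mu]_y F y.
  by move=> F0; exact: integral_ge0.
rewrite (eq_integral (fun y => (\int[mu]_z Psi x y z) + B y)); last first.
  move=> y _; rewrite integral_PsiE /B /test.
  have := stop_ge0 y; rewrite le_eqVlt => /predU1P[s0|s0]; last first.
    by rewrite s0 mule0 adde0.
  by rewrite avg_stop0// -s0 ltxx mule0 add0e.
rewrite ge0_integralD//; last by move=> y _; exact: iP0.
rewrite (@fubini_tonelli _ _ T T R mu mu (fun w => Psi x w.1 w.2))//=.
rewrite -ge0_integralD//; last by move=> y _; exact: iP0.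
apply: (@le_trans _ _ (\int[mu]_z ((kap / 2 `^ g)%:E * H (stop x / 2)%R z))).
  rewrite ge0_integralZl//; last 2 first.
  - exact/mH/ltW.
  - by rewrite lee_fin divr_ge0// powR_ge0.
  apply: (@le_trans _ _ ((kap / 2 `^ g)%:E * (t / 2)%:E)).
    rewrite -EFinM lee_fin /test_const -/kap le_eqVlt; apply/orP; left; apply/eqP.
    by rewrite invfM; ring.
  by rewrite lee_wpmul2l// lee_fin divr_ge0// powR_ge0.
apply: ge0_le_integral => //.
- by move=> z _; rewrite mule_ge0// lee_fin divr_ge0// powR_ge0.
- by apply: emeasurable_funM => //; exact/mH/ltW.
- exact: emeasurable_funD.
move=> z _; rewrite /H; case: ifPn => lz; last first.
  by rewrite mule0 adde_ge0// iP0.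
(* The shift stop x / 2 is used here: doubled, it is stop x, which dominates stop z up to the
   distance. *)
have hz : (stop z + dist x z <= 2 * (stop x / 2 + dist x z))%R.
  rewrite mulrDr mulrCA divff// mulr1 mulr_natl mulr2n addrA lerD2r (distC x z).
  exact: stop_lipschitz.
have Kz0 : 0 <= ker (stop z + dist x z)%R * f z by rewrite mule_ge0 ?ker_ge0.
apply: (@le_trans _ _ (kap%:E * (ker (stop z + dist x z)%R * f z))).
  apply: (@le_trans _ _ ((kap / 2 `^ g)%:E * ((2 `^ g)%:E * (ker (stop z + dist x z)%R * f z)))).
    rewrite lee_wpmul2l ?lee_fin ?divr_ge0 ?powR_ge0// muleA lee_wpmul2r//.
    apply: ker_scale; [exact: g0|exact: ltr0Sn| |exact: hz].
    exact: addr_ge0 (stop_ge0 z) (dist_ge0 x z).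
  by rewrite muleA -EFinM divfK// gt_eqF// powR_gt0.
have := stop_ge0 z; rewrite le_eqVlt => /predU1P[s0|s0]; last first.
  apply: (@le_trans _ _ (\int[mu]_y Psi x y z)); last by rewrite leeDl.
  apply: le_trans (Psi_integral_ge x s0).
  by rewrite lee_wpmul2r// lee_fin ge_min lexx orbT.
apply: (@le_trans _ _ (B z)); last by rewrite leeDr// iP0.
rewrite /B -s0 ltxx lz add0r -[leRHS]mul1e lee_wpmul2r ?mule_ge0 ?ker_ge0//.
by rewrite lee_fin ge_min lexx.
Qed.

(** * The L^s norm of the test function *)

Section test_norm.
Variables (s p : R).
Hypotheses (s1 : (1 < s)%R) (p1 : (1 < p)%R) (gpD : (g * p < D)%R).

Let s0 : (0 < s)%R. Proof. exact: lt_trans s1. Qed.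
Let p0 : (0 < p)%R. Proof. exact: lt_trans p1. Qed.
Let gp0 : (0 < g * p)%R. Proof. exact: mulr_gt0. Qed.

Let dist_if_measurable y (r : R) (F : T -> \bar R) : measurable_fun [set: T] F ->
  measurable_fun [set: T] (fun z => if (dist y z < r)%R then F z else 0).
Proof.
by move=> mF; apply: measurable_fun_ifT => //; apply: measurable_fun_ltr => //; exact: mdistl.
Qed.

Let integral_mballE y (r : R) (F : T -> \bar R) :
  \int[mu]_(z in mball y r) F z = \int[mu]_z (if (dist y z < r)%R then F z else 0).
Proof.
rewrite integral_mkcond; apply: eq_integral => z _; rewrite patchE.
case: ifPn => [|/negP]; rewrite inE /mball/= => yz; first by rewrite yz.
by case: ifP.
Qed.

(** [le_young_pow] is applied at the z-dependent level N * (2 stop y + dist y z)^(-g), so that the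
    first term integrates to N times [pot (2 * stop y) y], at most N t. *)
Let pot0_le_young y x N : (0 < stop y)%R -> (0 < N)%R ->
  pot 0 x <= (N * t)%:E + (N `^ (1 - p))%:E * \int[mu]_z
    (((2 * stop y + dist y z) `^ (g * (p - 1)))%:E * (xpow (dist x z)%:E (- (g * p)) * f z)).
Proof.
move=> sy N0.
have sy2 : (0 < 2 * stop y)%R by rewrite mulr_gt0.
have v0 z : (0 < 2 * stop y + dist y z)%R by rewrite ltr_wpDr.
have mW : measurable_fun [set: T] (fun z => ((2 * stop y + dist y z) `^ (g * (p - 1)))%:E *
    (xpow (dist x z)%:E (- (g * p)) * f z)).
  apply: emeasurable_funM.
    apply/measurable_EFinP; apply: (measurableT_comp (measurable_powR _)).
    by apply: measurable_funD => //; exact: mdistl.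
  apply: emeasurable_funM => //; apply: measurable_xpow.
    by apply/measurable_EFinP; exact: mdistl.
  by move=> z; rewrite lee_fin.
have W0 z : 0 <= ((2 * stop y + dist y z) `^ (g * (p - 1)))%:E *
    (xpow (dist x z)%:E (- (g * p)) * f z).
  by rewrite !mule_ge0 ?xpow_ge0 ?lee_fin ?powR_ge0.
have mP := measurable_pot_integrand y (ltW sy2).
have P0 z : 0 <= ker (2 * stop y + dist y z)%R * f z by rewrite mule_ge0 ?ker_ge0.
apply: (@le_trans _ _ (N%:E * pot (2 * stop y)%R y + (N `^ (1 - p))%:E * \int[mu]_z
    (((2 * stop y + dist y z) `^ (g * (p - 1)))%:E * (xpow (dist x z)%:E (- (g * p)) * f z)))).
  rewrite -!ge0_integralZl//; [|by rewrite lee_fin powR_ge0|by rewrite lee_fin ltW].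
  rewrite -ge0_integralD//; last 4 first.
  - by move=> z _; rewrite mule_ge0// lee_fin ltW.
  - exact: emeasurable_funM.
  - by move=> z _; rewrite mule_ge0// lee_fin powR_ge0.
  - exact: emeasurable_funM.
  apply: ge0_le_integral => //.
  - by move=> z _; rewrite mule_ge0 ?ker_ge0.
  - exact: measurable_pot_integrand.
  - by apply: emeasurable_funD; exact: emeasurable_funM.
  move=> z _; rewrite add0r ker_powR//.
  have vz0 := powR_gt0 (- g) (v0 z).
  have := le_young_pow p1 (mulr_gt0 N0 vz0) (ker_ge0 g (dist x z)).
  rewrite powRM ?(ltW N0) ?(ltW vz0)// -powRrM.
  rewrite (_ : - g * (1 - p) = g * (p - 1))%R; last by ring.
  move=> /(lee_wpmul2r (f0 z)) /le_trans; apply.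
  rewrite ge0_muleDl; last 2 first.
  - by rewrite lee_fin mulr_ge0// ltW.
  - by rewrite mule_ge0 ?poweR_ge0// lee_fin mulr_ge0 ?powR_ge0.
  rewrite (ker_EFin g (v0 z)) le_eqVlt; apply/orP; left; apply/eqP; congr (_ + _); first by rewrite EFinM muleA.
  by rewrite EFinM -!muleA.
rewrite leeD2r// EFinM lee_wpmul2l ?lee_fin ?(ltW N0)//; apply: pot_le_stop => //.
by rewrite mulr_natl mulr2n ltrDl.
Qed.

(** After [pow_le_of_young] and Tonelli, [ker_ball_integral] for the exponent g p turns dist^(-g p)
    into (2 stop y + dist y z)^(-g p). The weight [w] brings the exponent back to -g, and
    [pot (2 * stop y) y] remains, at most t. *)
Lemma pot0_pow_integral y : (0 < stop y)%R ->
  \int[mu]_(x in mball y (stop y / 2)%R) pot 0 x `^ p <=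
  (2 `^ p * ball_const (g * p) * t `^ p * stop y `^ D)%:E.
Proof.
move=> sy.
pose w z := ((2 * stop y + dist y z) `^ (g * (p - 1)))%R.
pose W x z := (w z)%:E * (xpow (dist x z)%:E (- (g * p)) * f z).
have mW : measurable_fun [set: T * T] (fun u : T * T => W u.1 u.2).
  apply: emeasurable_funM.
    apply/measurable_EFinP; apply: (measurableT_comp (measurable_powR _)).
    by apply: measurable_funD => //; exact: (measurableT_comp (mdistl y) measurable_snd).
  apply: emeasurable_funM; last exact: (measurableT_comp mf measurable_snd).
  by apply: measurable_xpow; [exact/measurable_EFinP|move=> u; rewrite lee_fin].
have W0 x z : 0 <= W x z by rewrite !mule_ge0 ?xpow_ge0 ?lee_fin ?powR_ge0.
have mW1 : measurable_fun [set: T] (fun x => \int[mu]_z W x z).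
  exact: (@measurable_fun_fubini_tonelli_F _ _ T T R mu (fun u => W u.1 u.2)).
have c0 : 0 <= (2 `^ p * t `^ (p - 1))%:E by rewrite lee_fin mulr_ge0 ?powR_ge0.
apply: (@le_trans _ _ (\int[mu]_(x in mball y (stop y / 2)%R)
    ((2 `^ p * t `^ (p - 1))%:E * \int[mu]_z W x z))).
  apply: ge0_le_integral; first exact: measurable_mball.
  - by move=> x _; rewrite poweR_ge0.
  - apply: measurable_funTS; exact: (measurableT_comp (measurable_poweR p) mpot0).
  - by apply: measurable_funTS; exact: emeasurable_funM.
  move=> x _; apply: pow_le_of_young => //; first exact: pot_ge0.
    by apply: integral_ge0.
  by move=> N N0; exact: pot0_le_young.
rewrite ge0_integralZl//; last 3 first.
- exact: measurable_mball.
- exact: measurable_funTS.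
- by move=> x _; exact: integral_ge0.
rewrite integral_mballE.
pose V x z := if (dist y x < stop y / 2)%R then W x z else 0.
rewrite (eq_integral (fun x => \int[mu]_z V x z)); last first.
  by move=> x _; rewrite /V; case: ifP => // _; rewrite integral0.
have mV : measurable_fun [set: T * T] (fun u : T * T => V u.1 u.2).
  apply: measurable_fun_ifT; [|exact: mW|exact: measurable_cst].
  apply: measurable_fun_ltr; last exact: measurable_cst.
  exact: (measurableT_comp (mdistl y) measurable_fst).
have V0 x z : 0 <= V x z by rewrite /V; case: ifP.
rewrite (@fubini_tonelli _ _ T T R mu mu (fun u => V u.1 u.2))//=.
pose K := (ball_const (g * p) * stop y `^ D)%R.
have K0 : (0 <= K)%R by rewrite mulr_ge0 ?powR_ge0// ltW// ball_const_gt0.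
have sy2 : (0 < 2 * stop y)%R by rewrite mulr_gt0.
have v0 z : (0 < 2 * stop y + dist y z)%R by rewrite ltr_wpDr.
apply: (@le_trans _ _ ((2 `^ p * t `^ (p - 1))%:E * (K%:E * t%:E))).
  rewrite lee_wpmul2l//.
  apply: (@le_trans _ _ (K%:E * pot (2 * stop y)%R y)); last first.
    rewrite lee_wpmul2l ?lee_fin//; apply: pot_le_stop => //.
    by rewrite mulr_natl mulr2n ltrDl.
  have mP := measurable_pot_integrand y (ltW sy2).
  have P0 z : 0 <= ker (2 * stop y + dist y z)%R * f z by rewrite mule_ge0 ?ker_ge0.
  rewrite -ge0_integralZl//.
  apply: ge0_le_integral => //.
  - by move=> z _; exact: integral_ge0.
  - exact: (@measurable_fun_fubini_tonelli_G _ _ T T R mu (fun u => V u.1 u.2)).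
  - exact: emeasurable_funM.
  move=> z _.
  apply: (@le_trans _ _ ((w z)%:E * f z * \int[mu]_(x in mball y (stop y / 2)%R) xpow (dist x z)%:E (- (g * p)))).
    rewrite integral_mballE -ge0_integralZl//; last 3 first.
    - apply: dist_if_measurable; apply: measurable_xpow.
        by apply/measurable_EFinP; exact: mdistr.
      by move=> x; rewrite lee_fin.
    - by move=> x _; case: ifP => // _; exact: xpow_ge0.
    - by rewrite mule_ge0// lee_fin powR_ge0.
    rewrite le_eqVlt; apply/orP; left; apply/eqP; apply: eq_integral => x _.
    by rewrite /V; case: ifP => _; rewrite ?mule0// /W -muleA (muleC (f z)).
  have := ker_ball_integral gp0 gpD y z sy; rewrite -/K.
  under eq_integral do rewrite unlock.
  rewrite ker_EFin// ker_EFin// => H.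
  apply: (@le_trans _ _ ((w z)%:E * f z * (K%:E * ((2 * stop y + dist y z) `^ (- (g * p)))%:E))).
    by rewrite lee_wpmul2l// mule_ge0// lee_fin powR_ge0.
  rewrite muleCA lee_wpmul2l ?lee_fin// muleAC -EFinM lee_wpmul2r// lee_fin.
  rewrite /w -powRD; last by rewrite (gt_eqF (v0 z)) implybT.
  by rewrite le_eqVlt; apply/orP; left; apply/eqP; congr (_ `^ _)%R; ring.
rewrite -!EFinM lee_fin le_eqVlt; apply/orP; left; apply/eqP.
rewrite /K -[in RHS](mulr_powRB1 (ltW t0) p0); ring.
Qed.

Definition avg_const : R := (2 `^ s * (2 `^ p * ball_const (g * p)) `^ (s - 1))%R.

Let F z : \bar R := f z `^ s * xpow (pot 0 z) (- (p * (s - 1))).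

Let F0 z : 0 <= F z. Proof. by rewrite /F mule_ge0 ?poweR_ge0 ?xpow_ge0. Qed.

Let mF : measurable_fun [set: T] F.
Proof.
apply: emeasurable_funM; first exact: (measurableT_comp (measurable_poweR s) mf).
by apply: measurable_xpow => // z; exact: pot_ge0.
Qed.

Let mpotp : measurable_fun [set: T] (fun z => pot 0 z `^ p).
Proof. exact: (measurableT_comp (measurable_poweR p) mpot0). Qed.

(** This is [le_young_pow] at level N v^p with v = [pot 0 z]; the exponent p (s - 1) of [F]
    originates here. *)
Let f_le_young N z : (0 < N)%R -> 0 < pot 0 z ->
  f z <= N%:E * pot 0 z `^ p + (N `^ (1 - s))%:E * F z.
Proof.
move=> N0; rewrite /F; case: (pot 0 z) => [v|_|//]; last first.
  rewrite poweRyr ?gt_eqF// gt0_muley ?lte_fin// addye ?leey//.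
  by rewrite gt_eqF// (lt_le_trans ltNy0)// !mule_ge0 ?poweR_ge0 ?xpow_ge0 ?lee_fin ?powR_ge0.
rewrite lte_fin => v0; have vp0 := powR_gt0 p v0.
have := le_young_pow s1 (mulr_gt0 N0 vp0) (f0 z).
rewrite powRM ?(ltW N0) ?(ltW vp0)// -powRrM xpow_EFin//.
rewrite (_ : - (p * (s - 1)) = p * (1 - s))%R; last by ring.
by rewrite poweR_EFin EFinM [in X in _ <= _ + X -> _]EFinM -muleA (muleC (f z `^ s)).
Qed.

(** Hoelder's inequality on the ball with weight v^p; the powers of rho = [stop y] combine as
    rho^(-D s) * rho^(D (s - 1)) = rho^(-D). *)
Lemma avg_pow y : (0 < stop y)%R ->
  avg y `^ s <= (avg_const * t `^ (p * (s - 1)))%:E *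
    \int[mu]_z (if (dist y z < stop y / 2)%R then (stop y `^ (- D))%:E * F z else 0).
Proof.
move=> sy; set rho := stop y.
set near := fun z => (dist y z < rho / 2)%R.
set M := (2 `^ p * ball_const (g * p) * t `^ p * rho `^ D)%R.
have B0 : (0 < 2 `^ p * ball_const (g * p))%R by rewrite mulr_gt0 ?powR_gt0 ?ball_const_gt0.
have M0 : (0 < M)%R by rewrite /M !mulr_gt0 ?powR_gt0 ?ball_const_gt0.
set Z := \int[mu]_z (if near z then F z else 0).
have Z0 : 0 <= Z by apply: integral_ge0 => z _; case: ifP.
have mFn : measurable_fun [set: T] (fun z => if near z then F z else 0).
  exact: dist_if_measurable.
set X := \int[mu]_z (if near z then f z else 0).
have X0 : 0 <= X by apply: integral_ge0 => z _; case: ifP.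
have XZ : X `^ s <= (2 `^ s * M `^ (s - 1))%:E * Z.
  apply: pow_le_of_young => // N N0.
  apply: (@le_trans _ _ (N%:E * (\int[mu]_(z in mball y (rho / 2)%R) pot 0 z `^ p) +
      (N `^ (1 - s))%:E * Z)); last first.
    rewrite leeD2r// EFinM; apply: lee_wpmul2l; first by rewrite lee_fin ltW.
    exact: pot0_pow_integral.
  have N0' : 0 <= N%:E by rewrite lee_fin ltW.
  have c0 : 0 <= (N `^ (1 - s))%:E by rewrite lee_fin powR_ge0.
  have mpn : measurable_fun [set: T] (fun z => if (dist y z < rho / 2)%R then pot 0 z `^ p else 0).
    exact: dist_if_measurable.
  have pn0 z : 0 <= (if (dist y z < rho / 2)%R then pot 0 z `^ p else 0).
    by case: ifP => // _; exact: poweR_ge0.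
  have Fn0 z : 0 <= (if near z then F z else 0) by case: ifP.
  rewrite integral_mballE -!ge0_integralZl//.
  rewrite -ge0_integralD//; last 4 first.
  - by move=> z _; exact: mule_ge0.
  - exact: emeasurable_funM.
  - by move=> z _; exact: mule_ge0.
  - exact: emeasurable_funM.
  apply: ge0_le_integral => //.
  - by move=> z _; case: ifP.
  - exact: dist_if_measurable.
  - by apply: emeasurable_funD; exact: emeasurable_funM.
  move=> z _; rewrite -/(near z); case: ifPn => [yz|_]; last by rewrite !mule0 adde0.
  (* By the Lipschitz property [stop] is positive on the ball, so v > t there. *)
  apply: f_le_young => //; apply: (@lt_trans _ _ t%:E); first by rewrite lte_fin.
  apply: lt_pot0_stop; have := stop_lipschitz y z; rewrite -/rho => h.
  exact: gt0_of_near yz h (dist_ge0 y z).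
rewrite (eq_integral (fun z => (rho `^ (- D))%:E * (if near z then F z else 0))); last first.
  by move=> z _; rewrite -/(near z); case: ifP => //; rewrite mule0.
rewrite ge0_integralZl//; last 2 first.
- by move=> z _; case: ifP.
- by rewrite lee_fin powR_ge0.
rewrite -/Z /avg -/rho -/X poweRM ?lee_fin ?powR_ge0// poweR_EFin -powRrM.
apply: (@le_trans _ _ ((rho `^ (- D * s))%:E * ((2 `^ s * M `^ (s - 1))%:E * Z))).
  by rewrite lee_wpmul2l// lee_fin powR_ge0.
rewrite !muleA -!EFinM lee_wpmul2r// lee_fin le_eqVlt; apply/orP; left; apply/eqP.
have rho0 : (0 < rho)%R by [].
rewrite /M /avg_const powRM ?powR_ge0//; last by rewrite mulr_ge0 ?powR_ge0// ltW.
rewrite powRM ?powR_ge0 ?(ltW B0)// -!powRrM.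
have -> : (rho `^ (- D) = rho `^ (- D * s) * rho `^ (D * (s - 1)))%R.
  rewrite -powRD; last by rewrite (gt_eqF rho0) implybT.
  by congr (_ `^ _)%R; ring.
ring.
Qed.

(** The first summand comes from the averages and the overlap bound, the second from points with
    [stop] zero. *)
Definition test_norm_const : R :=
  (avg_const * (Cu * (2 / 3) `^ (- D)) + 2 `^ (g * (p * (s - 1))))%R.

Let Theta y z : \bar R :=
  if (dist y z < stop y / 2)%R then (stop y `^ (- D))%:E * F z else 0.

(** Bounded overlap: the y whose ball contains z satisfy dist y z < stop z and stop y >= 2/3 stop z.
    There are none if [stop z] is 0; otherwise v(z) > t > [low], so the restriction on the right is
    free. *)
Let Theta_integral_le z : \int[mu]_y Theta y z <=
  (Cu * (2 / 3) `^ (- D))%:E * (if low%:E < pot 0 z then F z else 0).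
Proof.
have : (0 <= stop z)%R by exact: stop_ge0.
rewrite le_eqVlt => /predU1P[sz|sz].
  rewrite integral0_eq; last first.
    move=> y _; rewrite /Theta; case: ifP => // h.
    by have := gt0_of_near h (stop_lipschitz y z) (dist_ge0 y z); rewrite -sz ltxx.
  rewrite mule_ge0//; last by case: ifP.
  by rewrite lee_fin mulr_ge0 ?powR_ge0// ltW.
have -> : low%:E < pot 0 z.
  by apply: (lt_trans _ (lt_pot0_stop sz)); rewrite lte_fin.
have sz3 : (0 < 2 / 3 * stop z)%R by rewrite mulr_gt0// divr_gt0.
apply: (@le_trans _ _ (\int[mu]_(y in mball z (stop z)) cst (((2 / 3 * stop z) `^ (- D))%:E * F z) y)).
  rewrite integral_mballE; apply: ge0_le_integral => //.
  - by move=> y _; rewrite /Theta; case: ifP => // _; rewrite mule_ge0// lee_fin powR_ge0.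
  - apply: measurable_fun_ifT.
      exact: (measurableT_comp measurable_near (measurable_pair2 z)).
      apply: emeasurable_funM => //; apply/measurable_EFinP.
      exact: (measurableT_comp (measurable_powR (- D)%R) measurable_stop).
    exact: measurable_cst.
  - apply: dist_if_measurable; exact: measurable_cst.
  move=> y _; rewrite /Theta; case: ifPn => h; last first.
    by case: ifP => // _; rewrite mule_ge0// lee_fin powR_ge0.
  have h1 := stop_lipschitz y z; have h2 := stop_lipschitz z y.
  rewrite (distC z y) in h2 *.
  have [zy sy] := near_of_half sz h h1 h2.
  rewrite zy lee_wpmul2r// lee_fin; apply: ler_powRN; [exact: ltW|exact: sz3|exact: sy].
rewrite [leLHS](integral_cst mu (measurable_mball z (stop z))).
apply: (@le_trans _ _ (((2 / 3 * stop z) `^ (- D))%:E * F z * (Cu * stop z `^ D)%:E)).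
  apply: lee_wpmul2l; last exact: mu_ball_le.
  by rewrite mule_ge0// lee_fin powR_ge0.
rewrite muleAC -EFinM lee_wpmul2r// lee_fin le_eqVlt; apply/orP; left; apply/eqP.
rewrite powRM ?(ltW sz)// mulrC mulrACA -[RHS]mulr1; congr (_ * _)%R.
rewrite mulrC -powRD; last by rewrite (gt_eqF sz) implybT.
by rewrite addNr powRr0.
Qed.

Lemma test_pow_integral :
  \int[mu]_y test y `^ s <= (test_norm_const * t `^ (p * (s - 1)))%:E *
    \int[mu]_z (if low%:E < pot 0 z then f z `^ s * xpow (pot 0 z) (- (p * (s - 1))) else 0).
Proof.
pose G z := if low%:E < pot 0 z then F z else 0.
rewrite -/(\int[mu]_z G z).
have mG : measurable_fun [set: T] G by exact: measurable_fun_ifT.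
have G0 z : 0 <= G z by rewrite /G; case: ifP.
have mTh : measurable_fun [set: T * T] (fun w : T * T => Theta w.1 w.2).
  apply: measurable_fun_ifT => //; apply: emeasurable_funM.
    apply/measurable_EFinP; apply: (measurableT_comp (measurable_powR (- D)%R)).
    exact: (measurableT_comp measurable_stop measurable_fst).
  exact: (measurableT_comp mF measurable_snd).
have Th0 y z : 0 <= Theta y z.
  by rewrite /Theta; case: ifP => // _; rewrite mule_ge0// lee_fin powR_ge0.
have mTh1 : measurable_fun [set: T] (fun y => \int[mu]_z Theta y z).
  exact: (@measurable_fun_fubini_tonelli_F _ _ T T R mu (fun w => Theta w.1 w.2)).
have iTh0 y : 0 <= \int[mu]_z Theta y z by exact: integral_ge0.
pose c1 := (avg_const * t `^ (p * (s - 1)))%R.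
pose c2 := (2 `^ (g * (p * (s - 1))) * t `^ (p * (s - 1)))%R.
have c10 : 0 <= c1%:E.
  by rewrite lee_fin !mulr_ge0 ?powR_ge0.
have c20 : 0 <= c2%:E by rewrite lee_fin mulr_ge0 ?powR_ge0.
apply: (@le_trans _ _ (\int[mu]_y (c1%:E * (\int[mu]_z Theta y z) + c2%:E * G y))).
  apply: ge0_le_integral => //.
  - by move=> y _; exact: poweR_ge0.
  - exact: (measurableT_comp (measurable_poweR s) measurable_test).
  - by apply: emeasurable_funD; exact: emeasurable_funM.
  move=> y _; rewrite /test; case: ifPn => [sy|].
    apply: (le_trans (avg_pow sy)); rewrite leeDl// mule_ge0//.
  rewrite -leNgt => sy.
  have s0' : stop y = 0%R by apply/eqP; rewrite eq_le sy stop_ge0.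
  rewrite /G; case: ifPn => [ly|_]; last first.
    by rewrite poweR0r ?gt_eqF// mule0 adde0 mule_ge0.
  (* Where [stop] is 0 one has v <= 2^g t, so the weight v^(-p (s - 1)) is at least (2^g t)^(-p (s -
     1)). *)
  have := pot0_le_stop s0' => ut.
  apply: (@le_trans _ _ (c2%:E * F y)); last by rewrite leeDr// mule_ge0.
  have l0 : 0 < pot 0 y by apply: lt_trans ly; rewrite lte_fin.
  rewrite /F muleCA -[leLHS]mule1 lee_wpmul2l ?poweR_ge0//.
  move: l0 ut; case: (pot 0 y) => [v|//|//]; rewrite lte_fin lee_fin => v0 vt.
  rewrite xpow_EFin// -EFinM lee_fin /c2 powRrM -powRM ?powR_ge0 ?(ltW t0)//.
  rewrite powRN ler_pdivlMr ?powR_gt0// mul1r.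
  by apply: ge0_ler_powR; rewrite ?nnegrE ?(ltW v0) ?mulr_ge0 ?powR_ge0 ?subr_ge0 ?(ltW p0) ?(ltW s1) ?(ltW t0).
rewrite ge0_integralD//; last 4 first.
- by move=> y _; rewrite mule_ge0.
- exact: emeasurable_funM.
- by move=> y _; rewrite mule_ge0.
- exact: emeasurable_funM.
rewrite !ge0_integralZl// (@fubini_tonelli _ _ T T R mu mu (fun w => Theta w.1 w.2))//=.
rewrite /test_norm_const mulrDl EFinD ge0_muleDl; last 2 first.
- by rewrite lee_fin !mulr_ge0 ?powR_ge0// ltW.
- exact: c20.
rewrite leeD2r//.
rewrite (_ : (avg_const * _ * _)%:E = c1%:E * (Cu * (2 / 3) `^ (- D))%:E); last first.
  by rewrite -EFinM mulrAC.
rewrite -muleA lee_wpmul2l//.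
rewrite -ge0_integralZl//; last by rewrite lee_fin mulr_ge0 ?powR_ge0// ltW.
apply: ge0_le_integral; first exact: measurableT.
- by move=> z _; apply: integral_ge0 => y _; exact: Th0.
- exact: (@measurable_fun_fubini_tonelli_G _ _ T T R mu (fun w => Theta w.1 w.2)).
- exact: emeasurable_funM.
- by move=> z _; exact: Theta_integral_le.
- by move=> z _; exact: G0.
Qed.

Definition level_const : R := (test_norm_const * test_const `^ (- s))%R.

Lemma level_test_function : exists h : T -> \bar R,
  [/\ measurable_fun [set: T] h, (forall x, 0 <= h x),
      (forall x, (2 `^ g * t)%:E < pot 0 x -> 1 <= \int[mu]_y (ker (dist x y) * h y)) &
      \int[mu]_y h y `^ s <= (level_const * t `^ (p * (s - 1) - s))%:E *
        \int[mu]_z (if low%:E < pot 0 z then f z `^ s * xpow (pot 0 z) (- (p * (s - 1))) else 0)].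
Proof.
(* Normalises the lower bound of [pot_test_ge] to 1; its s-th power accounts for t^(-s). *)
pose a := ((test_const * t)^-1)%R.
have tc0 := test_const_gt0.
have a0 : (0 < a)%R by rewrite invr_gt0 mulr_gt0.
have a0' : 0 <= a%:E by rewrite lee_fin ltW.
exists (fun y => a%:E * test y); split.
- by apply: emeasurable_funM; [exact: measurable_cst|exact: measurable_test].
- by move=> x; rewrite mule_ge0// test_ge0.
- move=> x tx.
  rewrite (eq_integral (fun y => a%:E * (ker (dist x y) * test y))); last first.
    by move=> y _; rewrite muleCA.
  rewrite ge0_integralZl//; last 2 first.
  - apply: emeasurable_funM; last exact: measurable_test.
    by apply: measurable_ker => //; exact: mdistl.
  - by move=> y _; rewrite mule_ge0 ?ker_ge0 ?test_ge0.
  apply: (@le_trans _ _ (a%:E * (test_const * t)%:E)).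
    by rewrite -EFinM mulVf// gt_eqF// mulr_gt0.
  by apply: lee_wpmul2l => //; exact: pot_test_ge.
- rewrite (eq_integral (fun y => (a `^ s)%:E * test y `^ s)); last first.
    by move=> y _; rewrite poweRM ?test_ge0// poweR_EFin.
  have as0 : 0 <= (a `^ s)%:E by rewrite lee_fin powR_ge0.
  rewrite ge0_integralZl//; last 2 first.
  - exact: (measurableT_comp (measurable_poweR s) measurable_test).
  - by move=> y _; exact: poweR_ge0.
  apply: (le_trans (lee_wpmul2l as0 test_pow_integral)).
  rewrite muleA -EFinM lee_wpmul2r//; first by
    apply: integral_ge0 => z _; case: ifP => // _; rewrite mule_ge0 ?poweR_ge0 ?xpow_ge0.
  rewrite lee_fin le_eqVlt; apply/orP; left; apply/eqP.
  rewrite /a -(powR_inv1 (mulr_ge0 (ltW tc0) (ltW t0))) -powRrM mulN1r.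
  rewrite powRM ?(ltW tc0) ?(ltW t0)// powRD; last by rewrite (gt_eqF t0) implybT.
  by rewrite /level_const; ring.
Qed.

End test_norm.

End stopping_radius.

End potential.

End ahlfors_regular.

(** * Integration of the level estimate *)

Section layer_cake.
Context (R : realType).

(* Unlike [ge0_le_integral], the smaller function need not be measurable. *)
Lemma le_integral_nonmeasurable d (T : measurableType d) (mu : {measure set T -> \bar R})
    (D : set T) (f1 f2 : T -> \bar R) : (forall x, D x -> 0 <= f1 x) ->
  (forall x, D x -> f1 x <= f2 x) ->
  \int[mu]_(x in D) f1 x <= \int[mu]_(x in D) f2 x.
Proof.
move=> f10 f12; rewrite !ge0_integralE//; last first.
  by move=> x Dx; exact: le_trans (f10 x Dx) (f12 x Dx).
apply: ge_ereal_sup => _ /= [h hf1 <-]; apply: ereal_sup_ubound => /=.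
exists h => // x; apply: (le_trans (hf1 x)); rewrite !patchE; case: ifPn => //.
by rewrite inE; exact: f12.
Qed.

Lemma lebesgue_measure_sball (r : R) : (0 < r)%R ->
  lebesgue_measure [set x : R | (`|x| < r)%R] <= (2 * r `^ 1)%:E.
Proof.
move=> r0; rewrite (_ : [set x | _] = `](- r)%R, r[%classic); last first.
  by apply/seteqP; split => x /=; rewrite in_itv/= ltr_norml.
rewrite lebesgue_measure_itv/= lte_fin gtrN// -EFinB lee_fin opprK powRr1 ?(ltW r0)//.
lra.
Qed.

Context d (T : measurableType d) (mu : {sigma_finite_measure set T -> \bar R}).
Variables (f v : T -> \bar R) (s q b e K : R) (Phi : R -> \bar R).
Hypotheses (mf : measurable_fun [set: T] f) (mv : measurable_fun [set: T] v).
Hypotheses (f0 : forall x, 0 <= f x) (v0 : forall x, 0 <= v x).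
Hypotheses (b0 : (0 < b)%R) (q0 : (0 < q)%R) (e0 : (0 < e)%R) (K0 : (0 <= K)%R).
Hypotheses (sb : (0 < s - b)%R) (qsb : (0 < q - s + b)%R).
Hypothesis Phi0 : forall tau, 0 <= Phi tau.
Hypothesis Phi_le : forall tau, (0 < tau)%R ->
  Phi tau <= (K * tau `^ (- ((s - b) / q)))%:E *
    \int[mu]_x (if (e * tau `^ q^-1)%:E < v x then f x `^ s * xpow (v x) (- b) else 0).

(** The power of tau in the level estimate is -a, and a < 1 makes it integrable at 0. *)
Let a : R := ((s - b) / q)%R.
Let a0 : (0 < a)%R. Proof. exact: divr_gt0. Qed.
Let a1 : (a < 1)%R. Proof. rewrite ltr_pdivrMr// mul1r; move: qsb; lra. Qed.

Let F x : \bar R := f x `^ s * xpow (v x) (- b).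

Let F0 x : 0 <= F x. Proof. by rewrite mule_ge0 ?poweR_ge0 ?xpow_ge0. Qed.

Let mF : measurable_fun [set: T] F.
Proof.
apply: emeasurable_funM; first exact: (measurableT_comp (measurable_poweR s) mf).
exact: measurable_xpow.
Qed.

Definition layer_const : R := (K * (2 * shell_const 1 a * e `^ (- (q - s + b))))%R.

Lemma layer_const_ge0 : (0 <= layer_const)%R.
Proof.
apply: mulr_ge0 => //; apply: mulr_ge0; last exact: powR_ge0.
by apply: mulr_ge0 => //; apply/ltW/shell_const_gt0.
Qed.

(* The absolute value makes this a kernel on the whole line, so that
   [integral_shell] applies with centre 0. *)
Let Xi (w : R * T) : \bar R :=
  if (e * `|w.1| `^ q^-1)%:E < v w.2 then
    K%:E * (xpow `|w.1|%:E (- a) * F w.2) else 0.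

Let mXi : measurable_fun [set: R * T] Xi.
Proof.
apply: measurable_fun_ifT => //.
  apply: measurable_fun_lte; last exact: (measurableT_comp mv measurable_snd).
  apply/measurable_EFinP; apply: measurable_funM => //.
  apply: (measurableT_comp (measurable_powR _)).
  exact: (measurableT_comp (@normr_measurable R setT) measurable_fst).
apply: emeasurable_funM => //; apply: emeasurable_funM.
  apply: measurable_xpow; last by move=> w; rewrite lee_fin.
  apply/measurable_EFinP.
  exact: (measurableT_comp (@normr_measurable R setT) measurable_fst).
exact: (measurableT_comp mF measurable_snd).
Qed.

Let Xi0 w : 0 <= Xi w.
Proof. by rewrite /Xi; case: ifP => // _; rewrite mule_ge0 ?lee_fin// mule_ge0 ?xpow_ge0. Qed.

Let Xi_inner x : \int[lebesgue_measure]_t Xi (t, x) <=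
  layer_const%:E * (f x `^ s * xpow (v x) (q - s)).
Proof.
have c0 : 0 <= layer_const%:E by rewrite lee_fin layer_const_ge0.
have rhs0 : 0 <= layer_const%:E * (f x `^ s * xpow (v x) (q - s)).
  by rewrite !mule_ge0 ?poweR_ge0 ?xpow_ge0.
(* At v = +oo the factor v^(-b) is 0; at v = 0 no level qualifies. *)
rewrite /Xi/=; move: (v0 x) rhs0; case E : (v x) => [y||]//; last first.
  by move=> _ rhs0; rewrite integral0_eq// => t _; rewrite /F E xpowy ?oppr_lt0// !mule0; case: ifP.
rewrite lee_fin le_eqVlt => /predU1P[y0|y0] rhs0.
  rewrite integral0_eq// => t _; rewrite -y0 lte_fin ltNge.
  by rewrite mulr_ge0 ?powR_ge0// ltW.
(* e |t|^(1/q) < y forces |t| < r, and q (1 - a) = q - s + b makes r^(1 - a) the right power of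
   y. *)
pose r := ((y / e) `^ q)%R.
have ye : (0 < y / e)%R by rewrite divr_gt0.
have r0 : (0 < r)%R by rewrite powR_gt0.
have cond t : ((e * `|t| `^ q^-1)%:E < y%:E) -> (`|t| < r)%R.
  rewrite lte_fin -ltr_pdivlMl// mulrC => h.
  rewrite -[ltLHS](powRr1 (normr_ge0 t)) -[1%R](mulVf (lt0r_neq0 q0)) powRrM.
  by apply: gt0_ltr_powR => //; rewrite nnegrE ?powR_ge0// ltW.
have c1 : 0 <= K%:E * F x by rewrite mule_ge0.
apply: (@le_trans _ _ (K%:E * F x * \int[lebesgue_measure]_(t in [set t : R | (`|t| < r)%R]) xpow `|t|%:E (- a))).
  rewrite -ge0_integralZl//; last 3 first.
  - by have := @measurable_fun_ltr _ _ _ setT _ _ (@normr_measurable R setT)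
      (measurable_cst r) measurableT [set true] I; rewrite setTI.
  - apply: measurable_funTS; apply: measurable_xpow; last by move=> t; rewrite lee_fin.
    by apply/measurable_EFinP; exact: normr_measurable.
  - by move=> t _; exact: xpow_ge0.
  rewrite [leRHS]integral_mkcond; apply: le_integral_nonmeasurable => t _.
    by case: ifP => // _; rewrite mule_ge0 ?lee_fin// mule_ge0 ?xpow_ge0.
  rewrite patchE; case: ifPn => [/cond tr|_]; last first.
    by case: ifP => // _; rewrite mule_ge0 ?xpow_ge0.
  by rewrite mem_set// [in leLHS]muleCA [in leRHS]muleC.
apply: (@le_trans _ _ (K%:E * F x * (2 * shell_const 1 a * r `^ (1 - a))%:E)).
  apply: lee_wpmul2l => //.
  apply: (@integral_shell _ _ R lebesgue_measure (fun t : R => `|t|%R) 1%R a 2%R) => //.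
    exact: normr_measurable.
  by move=> t t0; exact: (lebesgue_measure_sball t0).
rewrite /F E !xpow_EFin// -!muleA -!EFinM muleCA -EFinM [leRHS]muleCA -EFinM.
rewrite lee_wpmul2l ?poweR_ge0// lee_fin le_eqVlt; apply/orP; left; apply/eqP.
rewrite /layer_const /r -powRrM (_ : q * (1 - a) = q - s + b)%R; last first.
  by rewrite /a; field; rewrite gt_eqF.
rewrite powRM ?invr_ge0 ?(ltW y0) ?(ltW e0)// -powR_inv1 ?(ltW e0)// -powRrM mulN1r.
have -> : (y `^ (q - s) = y `^ (- b) * y `^ (q - s + b))%R.
  rewrite -powRD; last by rewrite (gt_eqF y0) implybT.
  by congr (_ `^ _)%R; ring.
ring.
Qed.

(** [Phi] will be the capacity of {u^q > tau}. For fixed x the integral over the levels yields v^(q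
    - s + b), which turns v^(-b) into v^(q - s). *)
Lemma choquet_layer_cake :
  \int[lebesgue_measure]_(tau in `]0%R, +oo[) Phi tau <=
  layer_const%:E * \int[mu]_x (f x `^ s * xpow (v x) (q - s)).
Proof.
have mG : measurable_fun [set: T] (fun x => f x `^ s * xpow (v x) (q - s)).
  apply: emeasurable_funM; first exact: (measurableT_comp (measurable_poweR s) mf).
  exact: measurable_xpow.
have G0 x : 0 <= f x `^ s * xpow (v x) (q - s).
  by rewrite mule_ge0 ?poweR_ge0 ?xpow_ge0.
have c0 : 0 <= layer_const%:E by rewrite lee_fin layer_const_ge0.
have iXi0 t : 0 <= \int[mu]_x Xi (t, x) by exact: integral_ge0.
have miXi : measurable_fun [set: R] (fun t => \int[mu]_x Xi (t, x)).
  exact: (@measurable_fun_fubini_tonelli_F _ _ R T R mu Xi).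
apply: (@le_trans _ _ (\int[lebesgue_measure]_t \int[mu]_x Xi (t, x))).
  apply: (@le_trans _ _ (\int[lebesgue_measure]_(t in `]0%R, +oo[) \int[mu]_x Xi (t, x))).
    apply: le_integral_nonmeasurable => // t; rewrite /= in_itv/= andbT => t0.
    apply: (le_trans (Phi_le t0)); rewrite -/a.
    rewrite -ge0_integralZl//; last 3 first.
    - apply: measurable_fun_ifT => //; exact: measurable_fun_lte.
    - by move=> x _; case: ifP => // _; exact: F0.
    - by rewrite lee_fin mulr_ge0// powR_ge0.
    rewrite le_eqVlt; apply/orP; left; apply/eqP; apply: eq_integral => x _.
    rewrite /Xi/= gtr0_norm//; case: ifP => _; last by rewrite mule0.
    by rewrite xpow_EFin// EFinM -muleA.
  by apply: ge0_subset_integral.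
rewrite (@fubini_tonelli _ _ (measurableTypeR R) T R lebesgue_measure mu Xi)//.
rewrite -ge0_integralZl//.
apply: ge0_le_integral; first exact: measurableT.
- by move=> x _; apply: integral_ge0.
- exact: (@measurable_fun_fubini_tonelli_G _ _ (measurableTypeR R) T R lebesgue_measure Xi).
- exact: emeasurable_funM.
- by move=> x _; exact: Xi_inner.
Qed.

End layer_cake.

(** * Riesz potentials and capacities *)

Section bounded_support.
Context (R : realType) (n : nat).
Variable f : 'rV[R]_n.+1 -> \bar R.
Local Notation vanishes_on U := {ae leb R n, forall y, U y -> f y = 0}.

Let aeF : Filter (almost_everywhere (leb R n)).
Proof. exact: ae_filter_ringOfSetsType. Qed.

(** A finite subcover leaves only finitely many exceptional null sets. *)
Lemma vanishes_on_compact (A : set 'rV[R]_n.+1) : compact A ->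
  (forall x, A x -> exists2 U, nbhs x U & vanishes_on U) -> vanishes_on A.
Proof.
move=> cA HA.
have /choice[U HU] : forall x, exists U : set 'rV[R]_n.+1,
    A x -> nbhs x U /\ vanishes_on U.
  move=> x; have [Ax|nAx] := pselect (A x); last by exists setT.
  by have [U xU vU] := HA x Ax; exists U.
move: cA; rewrite compact_cover => /(_ _ A (fun x => (U x)^°)).
case.
- by move=> x _; exact: open_interior.
- by move=> x Ax; exists x => //; have [+ _] := HU x Ax.
move=> D DA AD.
have : forall s : seq 'rV[R]_n.+1, {subset s <= A} ->
    {ae leb R n, forall y, (exists2 x, x \in s & U x y) -> f y = 0}.
  elim=> [_|x s IH sA]; first by apply: aeW => y [].
  have /IH : {subset s <= A} by move=> z zs; apply: sA; rewrite inE zs orbT.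
  have /HU[_] : A x by apply: set_mem; apply: sA; rewrite inE eqxx.
  apply: (@filterS2 _ _ aeF) => y h1 h2 [z]; rewrite inE => /orP[/eqP->|zs] Uzy; first exact: h1.
  by apply: h2; exists z.
move=> /(_ (finmap.enum_fset D)) H.
have /H : {subset finmap.enum_fset D <= A} by move=> x xD; exact: DA.
apply: (@filterS _ _ aeF) => y h Ay; apply: h.
by have [x xD /interior_subset Uxy] := AD y Ay; exists x.
Qed.

(** The outside of a large ball is a countable union of compact shells that miss the essential
    support. *)
Lemma ess_support_bounded : compact (ess_support f) ->
  exists2 r : R, (0 < r)%R & vanishes_on [set y | (r <= `|y|)%R].
Proof.
move=> /compact_bounded [M [_ HM]].
pose r := (`|M| + 1)%R.
have r0 : (0 < r)%R by rewrite ltr_wpDl.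
have Kr x : ess_support f x -> (`|x| <= r)%R.
  by apply: HM; rewrite (le_lt_trans (ler_norm M))// ltrDl.
exists (r + 1)%R; first by rewrite addr_gt0.
have vm m : vanishes_on [set y | (r + 1 <= `|y| <= m%:R)%R].
  apply: vanishes_on_compact.
    apply: bounded_closed_compact.
      exists m%:R; split; first exact: num_real.
      by move=> x mx y /= /andP[_ ym]; rewrite (le_trans ym)// ltW.
    rewrite (_ : mkset _ = [set y | (r + 1 <= `|y|)%R] `&` [set y | (`|y| <= m%:R)%R]); last first.
      by apply/seteqP; split => y /=; [move=> /andP[]|move=> [-> ->]].
    apply: closedI.
      apply: (@closed_comp _ _ (fun y : 'rV[R]_n.+1 => `|y|%R) [set t : R | (r + 1 <= t)%R]).
        by move=> y _; exact: norm_continuous.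
      exact: closed_ge.
    apply: (@closed_comp _ _ (fun y : 'rV[R]_n.+1 => `|y|%R) [set t : R | (t <= m%:R)%R]).
      by move=> y _; exact: norm_continuous.
    exact: closed_le.
  move=> x /= /andP[rx _]; apply: contrapT => nx.
  have /Kr : ess_support f x by [].
  by rewrite leNgt (lt_le_trans _ rx)// ltrDl.
have : {ae leb R n, forall y m, (r + 1 <= `|y : 'rV[R]_n.+1| <= m%:R)%R -> f y = 0}.
  exact/ae_foralln.
apply: (@filterS _ _ aeF) => y h /= ry; apply: (h (Num.trunc `|y|%R).+1).
by rewrite ry ltW// truncnS_gt.
Qed.

End bounded_support.

(** * Comparison of the Riesz kernel with the sup-norm kernel *)

Section riesz_sup_norm.
Context (R : realType) (n : nat).
Implicit Types (x y : 'rV[R]_n.+1).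

Lemma coord_le_enorm x i : (`|x ord0 i| <= enorm x)%R.
Proof.
rewrite -(sqrtr_sqr (x ord0 i)) /enorm ler_wsqrtr// (bigD1 i)//= lerDl.
by apply: sumr_ge0 => j _; exact: sqr_ge0.
Qed.

Lemma norm_le_enorm x : (`|x| <= enorm x)%R.
Proof.
rewrite [leLHS]/Num.norm/= mx_normrE; apply: bigmax_le; first exact: sqrtr_ge0.
by move=> [i j] _ /=; rewrite (ord1 i) coord_le_enorm.
Qed.

Lemma enorm_le x : (enorm x <= n.+1%:R * `|x|)%R.
Proof.
rewrite -[leRHS]ger0_norm ?mulr_ge0// -sqrtr_sqr /enorm ler_wsqrtr//.
apply: (@le_trans _ _ (\sum_(i < n.+1) `|x|%R ^+ 2)%R).
  apply: ler_sum => i _; rewrite -[leLHS]real_normK ?num_real//.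
  by rewrite ler_sqr ?nnegrE// norm_rV_coord.
rewrite sumr_const card_ord -[leLHS]mulr_natl exprMn ler_wpM2r ?sqr_ge0//.
by rewrite expr2 -[leLHS]mulr1 ler_wpM2l// ler1n.
Qed.

(* Strict positivity would require the convergence of the Gamma integrals;
   if the constant were 0, the left-hand side of the theorem would vanish. *)
Lemma riesz_const_ge0 (alpha : R) : (0 <= riesz_const n alpha)%R.
Proof.
have G0 z : (0 <= Gamma z :> R)%R.
  rewrite /Gamma /Rintegral fine_ge0// integral_ge0// => t _.
  by rewrite lee_fin mulr_ge0 ?powR_ge0 ?expR_ge0.
by rewrite divr_ge0// !mulr_ge0 ?powR_ge0.
Qed.

Variable alpha : R.
Hypothesis alphaD : (alpha < n.+1%:R)%R.

Let g : R := (n.+1%:R - alpha)%R.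
Let g0 : (0 < g)%R. Proof. by rewrite subr_gt0. Qed.

Local Notation v f x := (\int[leb R n]_y (ker g (sdist x y) * f y)).

Lemma riesz_kernel_le x y :
  xpow (enorm (x - y)%R)%:E (alpha - n.+1%:R) <= ker g (sdist x y).
Proof.
rewrite unlock sdistE opprB; apply: xpow_nincr; first by rewrite subr_lt0.
  by rewrite lee_fin.
by rewrite lee_fin norm_le_enorm.
Qed.

Lemma riesz_kernel_ge x y :
  (n.+1%:R `^ (- g))%:E * ker g (sdist x y) <=
  xpow (enorm (x - y)%R)%:E (alpha - n.+1%:R).
Proof.
have <- : (- g = alpha - n.+1%:R)%R by rewrite opprB.
rewrite unlock sdistE -xpowM; [|by rewrite ltr0n|by rewrite lee_fin].
rewrite -EFinM; apply: xpow_nincr; [by rewrite oppr_lt0|by rewrite lee_fin sqrtr_ge0|].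
by rewrite lee_fin enorm_le.
Qed.

Lemma riesz_potential_le f x : (forall y, 0 <= f y) ->
  riesz_potential alpha f x <= (riesz_const n alpha)%:E * v f x.
Proof.
move=> f0; rewrite lee_wpmul2l ?lee_fin ?riesz_const_ge0//.
apply: le_integral_nonmeasurable => y _; first by rewrite mule_ge0// xpow_ge0.
by rewrite lee_wpmul2r// riesz_kernel_le.
Qed.

Lemma riesz_potential_ge f x : measurable_fun [set: Rn R n] f -> (forall y, 0 <= f y) ->
  (riesz_const n alpha * n.+1%:R `^ (- g))%:E * v f x <= riesz_potential alpha f x.
Proof.
move=> mf f0; rewrite EFinM -muleA lee_wpmul2l ?lee_fin ?riesz_const_ge0//.
have vf0 y : 0 <= ker g (sdist x y) * f y by rewrite mule_ge0 ?ker_ge0.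
have mvf : measurable_fun [set: Rn R n] (fun y => ker g (sdist x y) * f y).
  apply: emeasurable_funM; last exact: mf.
  exact: (measurable_ker g (measurable_sdistl x) (sdist_ge0 x)).
rewrite -(ge0_integralZl _ measurableT mvf (fun y _ => vf0 y)); last first.
  by rewrite lee_fin powR_ge0.
apply: le_integral_nonmeasurable => y _.
  by rewrite mule_ge0// lee_fin powR_ge0.
by rewrite muleA lee_wpmul2r// riesz_kernel_ge.
Qed.

(** At shift 1 the kernel is at most 1, so a bound of f on a ball outside which it vanishes
    suffices. *)
Lemma pot_bounded_compact_support f : measurable_fun [set: Rn R n] f ->
  (forall y, 0 <= f y) -> bounded_compact_support f ->
  pot (leb R n) (@sdist R n) g f 1%R 0%R < +oo.
Proof.
move=> mf f0 [fM /ess_support_bounded[r r0 fr]].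
(* The L^oo norm unfolds to the essential supremum when the whole space has positive measure. *)
have mu0 : 0 < leb R n setT.
  apply: lt_le_trans (le_lebesgue_outer (@subsetT _ (sball 0%R 1%R))).
  by apply: lt_le_trans (leb_sball_ge _ _) => //; rewrite lte_fin exprn_gt0.
pose M := ess_sup (leb R n) (abse \o f).
have Mfin : M < +oo by move: fM; rewrite unlock mu0.
have fleM := ess_sup_ge (leb R n) (abse \o f) : {ae leb R n, forall x, (abse \o f) x <= M}.
have M0 : 0 <= M.
  rewrite -(ess_sup_cst 0 mu0); apply: le_ess_sup; apply: aeW => x /=; exact: abse_ge0.
have kle (d : R) : (0 <= d)%R -> ker g (1 + d) <= 1.
  move=> d0; rewrite ker_EFin; last by rewrite ltr_wpDr.
  have := @ler_powRN _ g 1%R (1 + d)%R (ltW g0) ltr01; rewrite powR1 lee_fin; apply.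
  by rewrite lerDl.
have mball : measurable (sball 0%R r : set (Rn R n)) by exact: measurable_sball.
pose h (z : Rn R n) : \bar R := M * (\1_(sball 0%R r) z)%:E.
have mh : measurable_fun [set: Rn R n] h.
  apply: emeasurable_funM; first exact: measurable_cst.
  apply/measurable_EFinP; exact: measurable_indic.
have h0 z : 0 <= h z by rewrite mule_ge0// lee_fin.
apply: (@le_lt_trans _ _ (\int[leb R n]_z h z)).
  apply: ae_ge0_le_integral; first exact: measurableT.
  - by move=> z _; rewrite mule_ge0 ?ker_ge0.
  - apply: emeasurable_funM; last exact: mf.
    apply: measurable_ker; last by move=> z; rewrite addr_ge0 ?sdist_ge0.
    apply: measurable_funD; [exact: measurable_cst|exact: measurable_sdistl].
  - by move=> z _; exact: h0.
  - exact: mh.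
  apply: (@filterS2 _ _ (ae_filter_ringOfSetsType (leb R n)) _ _ _ _ fleM fr).
  move=> z /= fz zr _; rewrite /h indicE.
  have [/= zb|/negP] := boolP (z \in sball 0%R r).
    rewrite mule1 -[leRHS]mul1e; apply: lee_pmul => //; first exact: ker_ge0.
      by apply: kle; exact: sdist_ge0.
    by rewrite gee0_abs in fz.
  rewrite inE /sball/= => /negP; rewrite -leNgt sdistE sub0r normrN => /zr ->.
  by rewrite !mule0.
have mI : measurable_fun [set: Rn R n] (fun z => (\1_(sball 0%R r) z)%:E : \bar R).
  by apply/measurable_EFinP; exact: measurable_indic.
have I0 z : [set: Rn R n] z -> 0 <= (\1_(sball 0%R r) z)%:E :> \bar R.
  by rewrite lee_fin.
rewrite (ge0_integralZl _ measurableT mI I0 M0).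
rewrite (integral_indic (leb R n) measurableT mball) setIT lte_mul_pinfty//.
  by rewrite ge0_fin_numE.
by apply: le_lt_trans (leb_sball_le _ r0) _; rewrite ltry.
Qed.

End riesz_sup_norm.

(** * Capacity of the superlevel sets of a potential *)

Section capacity.
Context (R : realType) (n : nat) (alpha s : R).
Hypotheses (alphaD : (alpha < n.+1%:R)%R) (s1 : (1 < s)%R).
Implicit Types (E : set 'rV[R]_n.+1) (f : 'rV[R]_n.+1 -> \bar R).

Lemma riesz_cap_ge0 E : 0 <= riesz_cap alpha s E.
Proof. by apply: le_ereal_inf_tmp => _ [f _ <-]; exact: poweR_ge0. Qed.

Lemma le_riesz_cap E E' : E `<=` E' -> riesz_cap alpha s E <= riesz_cap alpha s E'.
Proof.
move=> EE'; apply: ereal_inf_le_tmp => _ [f [mf f0 hf] <-].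
by exists f => //; split => // x /EE'; exact: hf.
Qed.

Lemma riesz_cap_le E f : measurable_fun [set: Rn R n] f -> (forall x, 0 <= f x) ->
  (forall x, E x -> 1 <= riesz_potential alpha f x) ->
  riesz_cap alpha s E <= \int[leb R n]_x f x `^ s.
Proof.
move=> mf f0 hf; apply: ereal_inf_lbound; exists f => //.
rewrite powR_Lnorm; last by rewrite gt_eqF// (lt_trans _ s1).
by apply: eq_integral => x _; rewrite gee0_abs.
Qed.

Lemma riesz_cap_set0 : riesz_cap alpha s (set0 : set 'rV[R]_n.+1) = 0.
Proof.
apply/eqP; rewrite eq_le riesz_cap_ge0 andbT.
apply: (le_trans (@riesz_cap_le set0 (cst 0) (measurable_cst _) (fun=> lexx 0) _)) => //.
rewrite integral0_eq// => x _; rewrite poweR0r//.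
by rewrite gt_eqF// (lt_trans _ s1).
Qed.

Let g : R := (n.+1%:R - alpha)%R.
Let g0 : (0 < g)%R. Proof. by rewrite subr_gt0. Qed.
Let D0 : (0 < n.+1%:R :> R)%R. Proof. by rewrite ltr0n. Qed.

Let ball_le (x : Rn R n) (r : R) : (0 < r)%R ->
  leb R n [set y | (sdist x y < r)%R] <= (2 ^+ n.+1 * r `^ n.+1%:R)%:E.
Proof.
by move=> r0; rewrite powR_mulrn ?(ltW r0)// -exprMn; exact: leb_sball_le.
Qed.

Let ball_ge (x : Rn R n) (r : R) : (0 < r)%R ->
  (1 * r `^ n.+1%:R)%:E <= leb R n [set y | (sdist x y < r)%R].
Proof.
by move=> r0; rewrite mul1r powR_mulrn ?(ltW r0)//; exact: leb_sball_ge.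
Qed.

Let pow2 : (0 < 2 ^+ n.+1 :> R)%R. Proof. by rewrite exprn_gt0. Qed.

Variable f : 'rV[R]_n.+1 -> \bar R.
Hypotheses (mf : measurable_fun [set: Rn R n] f) (f0 : forall x, 0 <= f x).

Definition sup_pot (r : R) : 'rV[R]_n.+1 -> \bar R := pot (leb R n) (@sdist R n) g f r.

Lemma sup_pot0E x : sup_pot 0 x = \int[leb R n]_y (ker g (sdist x y) * f y).
Proof. by apply: eq_integral => y _; rewrite add0r. Qed.

Lemma measurable_sup_pot0 : measurable_fun [set: Rn R n] (sup_pot 0%R).
Proof.
exact: (measurable_pot (leb R n) (@measurable_sdist2 R n) (@sdist_ge0 R n) g mf f0 (lexx 0%R)).
Qed.

Hypothesis pot_fin : exists x0 r0, (0 < r0)%R /\ sup_pot r0 x0 < +oo.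
Variable p : R.
Hypotheses (p1 : (1 < p)%R) (gpD : (g * p < n.+1%:R)%R).

Let D : R := n.+1%:R.

Definition cap_const : R :=
  ((riesz_const n alpha * D `^ (- g)) `^ (- s) *
   level_const D (2 ^+ n.+1) 1 g s p)%R.

Lemma cap_const_ge0 : (0 <= cap_const)%R.
Proof.
rewrite mulr_ge0 ?powR_ge0// /level_const mulr_ge0 ?powR_ge0//.
rewrite /test_norm_const addr_ge0 ?powR_ge0// !mulr_ge0 ?powR_ge0// ltW.
Qed.

Lemma riesz_cap_level t : (0 < riesz_const n alpha)%R -> (0 < t)%R ->
  riesz_cap alpha s [set x | (2 `^ g * t)%:E < sup_pot 0%R x] <=
  (cap_const * t `^ (p * (s - 1) - s))%:E *
    \int[leb R n]_x (if (t / (2 * 2 `^ g))%:E < sup_pot 0%R x then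
       f x `^ s * xpow (sup_pot 0%R x) (- (p * (s - 1))) else 0).
Proof.
move=> gam0 t0.
have [h [mh h0 hlow hnorm]] := level_test_function (@measurable_sdist2 R n)
  (@sdist_ge0 R n) (@sdistC R n) (@sdist_tri R n) pow2 ltr01 ball_le ball_ge D0
  g0 mf f0 pot_fin t0 s1 p1 gpD.
(* Lower comparison factor between the Riesz and sup-norm potentials; dividing [h] by it gives an
   admissible function. *)
pose a := (riesz_const n alpha * D `^ (- g))%R.
have a0 : (0 < a)%R by rewrite mulr_gt0// powR_gt0.
have ai0 : 0 <= (a^-1)%:E by rewrite lee_fin invr_ge0 ltW.
have vh0 x y : 0 <= ker g (sdist x y) * h y by rewrite mule_ge0 ?ker_ge0.
have mvh x : measurable_fun [set: Rn R n] (fun y => ker g (sdist x y) * h y).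
  apply: emeasurable_funM; last exact: mh.
  exact: (measurable_ker g (measurable_sdistl x) (sdist_ge0 x)).
have mah : measurable_fun [set: Rn R n] (fun y => (a^-1)%:E * h y).
  by apply: emeasurable_funM; [exact: measurable_cst|exact: mh].
have ah0 y : 0 <= (a^-1)%:E * h y by rewrite mule_ge0.
apply: (le_trans (riesz_cap_le mah ah0 _)).
  move=> x /= /hlow hx; have H := riesz_potential_ge alphaD x mah ah0; apply: le_trans H.
  rewrite -/g -/D -/a.
  rewrite (eq_integral (fun y : Rn R n => (a^-1)%:E * (ker g (sdist x y) * h y))); last first.
    by move=> y _; rewrite muleCA.
  rewrite (ge0_integralZl _ measurableT (mvh x) (fun y _ => vh0 x y) ai0).
  by rewrite muleA -EFinM divff ?mul1e// gt_eqF.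
have as0 : 0 <= (a `^ (- s))%:E by rewrite lee_fin powR_ge0.
rewrite (eq_integral (fun y : Rn R n => (a `^ (- s))%:E * h y `^ s)); last first.
  move=> y _; rewrite poweRM// poweR_EFin; congr (_%:E * _).
  by rewrite -powR_inv1 ?(ltW a0)// -powRrM mulN1r.
have mhs : measurable_fun [set: Rn R n] (fun y => h y `^ s).
  exact: (measurableT_comp (measurable_poweR s) mh).
rewrite (ge0_integralZl _ measurableT mhs (fun y _ => poweR_ge0 (h y) s) as0).
apply: (le_trans (lee_wpmul2l as0 hnorm)).
by rewrite muleA -EFinM mulrA.
Qed.

End capacity.

(** For r >= 0 the bound a v <= u gives the claim, for r < 0 the bound u <= c v; the sum of both
    constants serves either sign. *)
Lemma le_xpow_equiv (R : realType) (a c r : R) (u v : \bar R) :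
  (0 < a)%R -> (0 < c)%R -> 0 <= v -> 0 <= u -> a%:E * v <= u -> u <= c%:E * v ->
  xpow v r <= (a `^ (- r) + c `^ (- r))%:E * xpow u r.
Proof.
move=> a0 c0 v0 u0 au uc.
have H (k : R) : (0 < k)%R -> xpow (k%:E * v) r <= xpow u r ->
    xpow v r <= (k `^ (- r))%:E * xpow u r.
  move=> k0 kv; apply: (@le_trans _ _ ((k `^ (- r))%:E * xpow (k%:E * v) r)).
    rewrite xpowM// muleA -EFinM -powRD; last by rewrite (gt_eqF k0) implybT.
    by rewrite addNr powRr0 mul1e.
  by rewrite lee_wpmul2l// lee_fin powR_ge0.
rewrite EFinD ge0_muleDl ?lee_fin ?powR_ge0//.
have [r0|r0] := leP 0%R r.
- apply: (le_trans (H a a0 _)); last by rewrite leeDl// mule_ge0 ?xpow_ge0 ?lee_fin ?powR_ge0.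
  by apply: xpow_ndecr => //; rewrite mule_ge0// lee_fin ltW.
- apply: (le_trans (H c c0 _)); last by rewrite leeDr// mule_ge0 ?xpow_ge0 ?lee_fin ?powR_ge0.
  exact: xpow_nincr.
Qed.

(** D / g and s / (s - 1) both exceed 1; p is midway between 1 and the smaller. *)
Lemma exists_exponent (R : realFieldType) (s g D : R) :
  (1 < s)%R -> (0 < g)%R -> (g < D)%R ->
  exists p : R, [/\ (1 < p)%R, (g * p < D)%R & (p * (s - 1) < s)%R].
Proof.
move=> s1 g0 gD; pose P := Num.min (D / g)%R (s / (s - 1))%R.
have s10 : (0 < s - 1)%R by rewrite subr_gt0.
have P1 : (1 < P)%R.
  by rewrite lt_min !ltr_pdivlMr// !mul1r gD gtrBl ltr01.
have [h1 h2] := midf_lt P1; exists ((1 + P) / 2)%R; split => //.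
- rewrite mulrC -ltr_pdivlMr//; apply: (lt_le_trans h2).
  by rewrite /P ge_min lexx.
- rewrite -ltr_pdivlMr//; apply: (lt_le_trans h2).
  by rewrite /P ge_min lexx orbT.
Qed.

(** * Zero normalising constant and identically infinite potential *)

Section degenerate.
Context (R : realType) (n : nat) (alpha s q : R).
Hypotheses (s1 : (1 < s)%R) (q0 : (0 < q)%R).
Variable f : 'rV[R]_n.+1 -> \bar R.

Lemma choquet_riesz_const0 : riesz_const n alpha = 0%R ->
  choquet (riesz_cap alpha s) (fun x => riesz_potential alpha f x `^ q) = 0.
Proof.
move=> g0; apply: integral0_eq => t; rewrite /= in_itv/= andbT => t0.
rewrite (_ : [set x | _] = set0) ?riesz_cap_set0//.
apply/seteqP; split => // x /=.
by rewrite /riesz_potential g0 mul0e poweR0r ?gt_eqF// lte_fin ltNge ltW.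
Qed.

(** Every superlevel set is the whole space, so the Choquet integral is its capacity times +oo,
    finite only if the capacity is 0. *)
Lemma choquet_infty_eq0 : (forall x, riesz_potential alpha f x = +oo) ->
  choquet (riesz_cap alpha s) (fun x => riesz_potential alpha f x `^ q) < +oo ->
  choquet (riesz_cap alpha s) (fun x => riesz_potential alpha f x `^ q) = 0.
Proof.
move=> uoo.
have -> : choquet (riesz_cap alpha s) (fun x => riesz_potential alpha f x `^ q) =
    riesz_cap alpha s (setT : set 'rV[R]_n.+1) * +oo.
  rewrite /choquet (eq_integral (cst (riesz_cap alpha s (setT : set 'rV[R]_n.+1)))); last first.
    move=> t _ /=; congr riesz_cap; apply/seteqP; split => // x _ /=.
    by rewrite uoo poweRyr ?gt_eqF// ltry.
  by rewrite integral_cst//; congr (_ * _); rewrite [LHS](lebesgue_measure_itv `]0%R, +oo[)/= ltry.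
have := riesz_cap_ge0 alpha s (setT : set 'rV[R]_n.+1).
rewrite le_eqVlt => /predU1P[<-|c0]; first by rewrite mul0e.
by rewrite gt0_muley// ltxx.
Qed.

End degenerate.

Theorem theorem1p1 (R : realType) (n : nat) (s alpha q : R)
  (hs : (1 < s)%R) (halpha0 : (0 < alpha)%R) (halpha : (alpha < n.+1%:R / s)%R)
  (hq : (1 <= q)%R) :
  exists A : R, (0 < A)%R /\
    forall f : 'rV[R]_n.+1 -> \bar R,
      measurable_fun [set: Rn R n] f ->
      (forall x, 0 <= f x) ->
      bounded_compact_support f \/
        cap_norm alpha s q (riesz_potential alpha f) < +oo ->
      choquet (riesz_cap alpha s) (fun x => riesz_potential alpha f x `^ q)
      <= A%:E *
         \int[leb R n]_x (f x `^ s * xpow (riesz_potential alpha f x) (q - s)).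
Proof.
have s0 : (0 < s)%R by exact: lt_trans hs.
have q0 : (0 < q)%R by exact: lt_le_trans hq.
have alphaD : (alpha < n.+1%:R)%R.
  apply: (lt_le_trans halpha); rewrite ler_pdivrMr// -[leLHS]mulr1.
  by rewrite ler_wpM2l// ltW.
have rhs0 (f : 'rV[R]_n.+1 -> \bar R) :
    0 <= \int[leb R n]_x (f x `^ s * xpow (riesz_potential alpha f x) (q - s)).
  by apply: integral_ge0 => x _; rewrite mule_ge0 ?poweR_ge0 ?xpow_ge0.
have [gam0|gam_neq0] := eqVneq (riesz_const n alpha) 0%R.
  exists 1%R; split => // f _ _ _; rewrite choquet_riesz_const0// mul1e.
  exact: rhs0.
have gam : (0 < riesz_const n alpha)%R by rewrite lt_neqAle eq_sym gam_neq0 riesz_const_ge0.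
set gamma := riesz_const n alpha in gam *.
pose g := (n.+1%:R - alpha)%R.
have g0 : (0 < g)%R by rewrite subr_gt0.
have gD : (g < n.+1%:R)%R by rewrite ltrBlDr ltrDl.
have [p [p1 gpD ps]] := exists_exponent hs g0 gD.
pose b := (p * (s - 1))%R.
have s10 : (0 < s - 1)%R by rewrite subr_gt0.
have b0 : (0 < b)%R by rewrite mulr_gt0// (lt_trans _ p1).
have sb : (0 < s - b)%R by rewrite subr_gt0.
have qsb : (0 < q - s + b)%R.
  rewrite (_ : q - s + b = (q - 1) + (p - 1) * (s - 1))%R; last by rewrite /b; ring.
  by rewrite ltr_wpDl ?subr_ge0// mulr_gt0// subr_gt0.
(* u > w implies v > 2^g (w / c); the low threshold of the level w / c is then e w. *)
pose c := (gamma * 2 `^ g)%R.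
have c0 : (0 < c)%R by rewrite mulr_gt0.
pose e := ((c * (2 * 2 `^ g))^-1)%R.
have e0 : (0 < e)%R by rewrite invr_gt0 mulr_gt0// mulr_gt0.
pose K := (cap_const n alpha s p * c `^ (s - b))%R.
have K0 : (0 <= K)%R by rewrite mulr_ge0 ?powR_ge0 ?cap_const_ge0.
pose a := (gamma * n.+1%:R `^ (- g))%R.
have a0 : (0 < a)%R by rewrite mulr_gt0// powR_gt0// ltr0n.
pose C3 := (a `^ (- (q - s)) + gamma `^ (- (q - s)))%R.
have C30 : (0 < C3)%R by rewrite addr_gt0// powR_gt0.
pose L := layer_const s q b e K.
have L0 : (0 <= L)%R by exact: layer_const_ge0.
(* The 1 ensures positivity, [L] being only nonnegative here. *)
exists (L * C3 + 1)%R; split; first by rewrite ltr_wpDl// mulr_ge0// ltW.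
move=> f mf f0 hf.
set u := riesz_potential alpha f.
have u0 x : 0 <= u x.
  rewrite mule_ge0 ?lee_fin ?(ltW gam)//; apply: integral_ge0 => y _.
  by rewrite mule_ge0 ?xpow_ge0.
pose v := sup_pot alpha f 0%R.
have uv x : u x <= gamma%:E * v x.
  by rewrite /v sup_pot0E; exact: riesz_potential_le.
have vu x : a%:E * v x <= u x.
  by rewrite /v sup_pot0E; exact: riesz_potential_ge.
have v0 x : 0 <= v x by exact: pot_ge0.
have mv : measurable_fun [set: Rn R n] v by exact: measurable_sup_pot0.
have A0 : 0 <= (L * C3 + 1)%:E by rewrite lee_fin addr_ge0// mulr_ge0// ltW.
(* If no shifted potential is finite anywhere, u is +oo everywhere. Bounded compact support excludes
   this; under the other hypothesis the Choquet integral is finite, hence 0. *)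
have [pot_fin|nfin] := pselect (exists x0 r0, (0 < r0)%R /\ sup_pot alpha f r0 x0 < +oo); last first.
  have uoo x : u x = +oo.
    have voo : v x = +oo.
      apply/eqP; rewrite eq_le leey/= leNgt; apply/negP => vx; apply: nfin.
      exists x, 1%R; split => //; apply: le_lt_trans vx.
      apply: (pot_mono (leb R n) (@measurable_sdist2 R n) (@sdist_ge0 R n) g0 mf f0) => //.
      by move=> z; rewrite lerD2r.
    by apply/eqP; rewrite eq_le leey/= (le_trans _ (vu x))// voo gt0_muley.
  case: hf => [bcs|cfin].
    exfalso; apply: nfin; exists 0%R, 1%R; split => //.
    exact: pot_bounded_compact_support.
  rewrite choquet_infty_eq0//; first by rewrite mule_ge0// rhs0.
  have {cfin} := lty_poweRy _ cfin; rewrite invr_eq0 gt_eqF// => /(_ isT).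
  by congr (choquet _ _ < _); apply/funext => x; rewrite gee0_abs// u0.
apply: (@le_trans _ _ (L%:E * \int[leb R n]_x (f x `^ s * xpow (v x) (q - s)))).
  apply: (@choquet_layer_cake R _ (Rn R n) (leb R n) f v s q b e K
    (fun tau => riesz_cap alpha s [set x | tau%:E < u x `^ q])) => //.
    by move=> tau; exact: riesz_cap_ge0.
  move=> tau tau0.
  pose w := (tau `^ q^-1)%R.
  have w0 : (0 < w)%R by rewrite powR_gt0.
  have t0 : (0 < w / c)%R by rewrite divr_gt0.
  apply: (@le_trans _ _ (riesz_cap alpha s [set x | (2 `^ g * (w / c))%:E < v x])).
    apply: le_riesz_cap => x /= taux.
    have wu : w%:E < u x.
      rewrite ltNge; apply/negP => uw; move: taux; apply/negP; rewrite -leNgt.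
      apply: (@le_trans _ _ (w%:E `^ q)).
        apply: gt0_ler_poweR => //; rewrite ?(ltW q0)// in_itv/= leey andbT//.
        by rewrite lee_fin ltW.
      by rewrite poweR_EFin /w -powRrM mulVf ?gt_eqF// powRr1// ltW.
    rewrite (_ : 2 `^ g * (w / c) = gamma^-1 * w)%R; last first.
      by rewrite /c; field; rewrite !gt_eqF.
    by rewrite EFinM lte_pdivrMl//; exact: lt_le_trans wu (uv x).
  apply: (le_trans (riesz_cap_level alphaD hs mf f0 pot_fin p1 gpD gam t0)).
  rewrite -/g -/v -/b.
  have -> : (w / c / (2 * 2 `^ g) = e * w)%R.
    by rewrite /e; field; rewrite !gt_eqF.
  rewrite (_ : cap_const n alpha s p * (w / c) `^ (b - s) = K * tau `^ (- ((s - b) / q)))%R//.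
  rewrite /K powRM ?invr_ge0 ?(ltW w0) ?(ltW c0)// -powR_inv1 ?(ltW c0)// -[in LHS]powRrM.
  rewrite mulN1r opprB /w -powRrM -[in RHS]mulrA [in RHS](mulrC (c `^ _)%R).
  by congr (_ * (_ `^ _ * _))%R; field; rewrite gt_eqF.
have mG : measurable_fun [set: Rn R n] (fun x => f x `^ s * xpow (v x) (q - s)).
  apply: emeasurable_funM; first exact: (measurableT_comp (measurable_poweR s) mf).
  exact: measurable_xpow.
have G0 x : 0 <= f x `^ s * xpow (v x) (q - s) by rewrite mule_ge0 ?poweR_ge0 ?xpow_ge0.
have Ci0 : 0 <= (C3^-1)%:E by rewrite lee_fin invr_ge0 ltW.
apply: (@le_trans _ _ ((L * C3)%:E * \int[leb R n]_x (f x `^ s * xpow (u x) (q - s)))); last first.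
  by rewrite lee_wpmul2r ?rhs0// lee_fin lerDl.
rewrite (EFinM L C3) -muleA.
apply: lee_wpmul2l; first by rewrite lee_fin.
(* The constant is moved inside the integral with v, whose integrand is known to be measurable,
   before comparing with the one with u. *)
apply: (@le_trans _ _ (C3%:E * ((C3^-1)%:E * \int[leb R n]_x (f x `^ s * xpow (v x) (q - s))))).
  by rewrite muleA -EFinM divff ?mul1e// gt_eqF.
apply: lee_wpmul2l; first by rewrite lee_fin ltW.
rewrite -(ge0_integralZl _ measurableT mG (fun x _ => G0 x) Ci0).
apply: le_integral_nonmeasurable => x _; first by rewrite mule_ge0.
rewrite muleCA; apply: lee_wpmul2l; first exact: poweR_ge0.
rewrite lee_pdivrMl//.
exact: le_xpow_equiv.
Qed.
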